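(* Let $V$ be a valuated matroid of rank $d$ on $[n]$, $L=L(V)$, and $A_1,\dots,A_d\in L$. Then $\mathcal A=\{\!\!\{A_1,\dots,A_d\}\!\!\}$ is a presentation of $V$ if and only if for every connected matroid $M\in\mathcal M(V)$: (1) $\sigma_0(\mathcal A,F,x_M)\le\operatorname{cork}_M(F)$ for every flat $F$ of $M$; and (2) $\sigma_\infty(\mathcal A,F,x_M)=\operatorname{cork}_M(F)$ for every cyclic flat $F$ of $M$.
   Context: $\mathbb T=\mathbb R\cup\{\infty\}$; $\mathbb{TP}^{n-1}=(\mathbb T^n\setminus\{(\infty,\dots,\infty)\})/\mathbb R(1,\dots,1)$. A valuated matroid $V$ of rank $d$ on $[n]$ is a point of $\mathbb{TP}^{\binom nd-1}$, coordinates $V_B$ indexed by $d$-subsets, such that for every $(d-1)$-set $A$ and $(d+1)$-set $C$ the minimum of $V_{A\cup\{j\}}+V_{C\setminus\{j\}}$ over $j\in C\setminus A$ is attained at least twice; $\underline V$ has bases $\{B:V_B<\infty\}$. For $x\in\mathbb R^n$, $V^x$ is the matroid whose bases are the $B$ minimizing $V_B-\sum_{i\in B}x_i$; $\mathcal M(V)$ is the set of $V^x$ all of whose loops are loops of $\underline V$. $L(V)=\{x\in\mathbb{TP}^{n-1}:$ for every $(d+1)$-set $C$, $\min_{j\in C}(x_j+V_{C\setminus\{j\}})$ attained at least twice$\}$. For a matroid $N$, $\operatorname{relint}(L_N)$ is the set of $x\in\mathbb R^n/\mathbb R(1,\dots,1)$ with $V^x=N$; for connected $M\in\mathcal M(V)$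 this is a single point $x_M$. Tropical Stiefel map: $\pi(A)_B=\min\{\sum_iA_{i,j_i}:\{j_1,\dots,j_d\}=B\}$ for $A\in\mathbb T^{d\times n}$; a presentation of $V$ is a multiset of $d$ points of $\mathbb{TP}^{n-1}$ whose coordinate vectors, as rows of $A$, give $\pi(A)=V$. $\operatorname{cork}_M(F)=\operatorname{rk}(M)-\operatorname{rk}_M(F)$; a cyclic flat is a flat that is a union of circuits. For $x$ with finite coordinates and $y\in\mathbb{TP}^{n-1}$, $\operatorname{relsupp}_x(y)$ is the set of $j$ at which $y_j-x_j$ does not attain its minimum. For $M\in\mathcal M(V)$, $x\in\operatorname{relint}(L_M)$ and a flat $F$ of $M$: $R_0(F,x,L)=\{y\in L:F\subseteq\operatorname{relsupp}_x(y)\}$; for $F$ a cyclic flat, $R_\infty(F,x,L)=\bigcap_{y\in\operatorname{relint}(L_{M|F\oplus M/F})}R_0(F,y,L)$, where $M|F\oplus M/F$ is the direct sum of the restriction to $F$ and contraction by $F$. $\sigma_0(\mathcal A,F,x)=|\{i:A_i\in R_0(F,x,L)\}|$ and $\sigma_\infty(\mathcal A,F,x)=|\{i:A_i\in R_\infty(F,x,L)\}|$.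
   Formalization: The underlying matroid of V is assumed connected; otherwise no M in M(V) is connected, conditions (1) and (2) are vacuous, and the claim fails (e.g. n = d = 2, V_{12} = 0, A_1 = A_2 = (∞,0)). *)

(* Defs.v *)
From mathcomp Require Import all_boot all_order all_algebra.
From mathcomp Require Import lra boolp reals constructive_ereal.

Set Implicit Arguments.
Unset Strict Implicit.
Unset Printing Implicit Defensive.
Import Order.TTheory GRing.Theory Num.Theory.

Local Open Scope nat_scope.

Section Matroid.
Variable T : finType.
Implicit Types (E F I C B : {set T}) (Bs : {set {set T}}).

Definition matroid_axiom E Bs : bool :=
  [&& Bs != set0,
      [forall B in Bs, B \subset E] &
      [forall B1 in Bs, forall B2 in Bs, forall e in B1 :\: B2,
         exists f in B2 :\: B1, (f |: (B1 :\ e)) \in Bs]].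

Record matroid := Matroid {
  ground : {set T};
  bases : {set {set T}};
  matroidP : matroid_axiom ground bases }.

Lemma matroid_inj (M N : matroid) :
  ground M = ground N -> bases M = bases N -> M = N.
Proof.
case: M N => [E1 Bs1 a1] [E2 Bs2 a2] /= eE eB.
by case: _ / eE a2 => a2; case: _ / eB a2 => a2; rewrite (bool_irrelevance a1 a2).
Qed.

Lemma matroid_axiomP E Bs :
  (exists B, B \in Bs) -> (forall B, B \in Bs -> B \subset E) ->
  (forall B1 B2 e, B1 \in Bs -> B2 \in Bs -> e \in B1 -> e \notin B2 ->
     exists f, [/\ f \in B2, f \notin B1 & (f |: (B1 :\ e)) \in Bs]) ->
  matroid_axiom E Bs.
Proof.
move=> [B BBs] sub exch; apply/and3P; split.
- by apply/set0Pn; exists B.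
- by apply/forall_inP.
- apply/forall_inP => B1 B1s; apply/forall_inP => B2 B2s.
  apply/forall_inP => e /setDP[e1 e2].
  have [f [f2 f1 fB]] := exch B1 B2 e B1s B2s e1 e2.
  by apply/exists_inP; exists f => //; rewrite inE f1.
Qed.

Lemma bases_neq0 (M : matroid) : exists B, B \in bases M.
Proof. by have /and3P[/set0Pn] := matroidP M. Qed.

Lemma bases_sub (M : matroid) B : B \in bases M -> B \subset ground M.
Proof. by have /and3P[_ /forall_inP h _] := matroidP M; apply: h. Qed.

Lemma bases_exchange (M : matroid) B1 B2 e :
  B1 \in bases M -> B2 \in bases M -> e \in B1 -> e \notin B2 ->
  exists f, [/\ f \in B2, f \notin B1 & (f |: (B1 :\ e)) \in bases M].
Proof.
have /and3P[_ _ /forall_inP h] := matroidP M => B1M B2M e1 e2.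
have /forall_inP/(_ _ B2M)/forall_inP/(_ e) := h _ B1M.
rewrite inE e1 e2 => /(_ isT)/exists_inP[f /setDP[f2 f1] fB].
by exists f.
Qed.

Definition rk (M : matroid) F : nat := \max_(B in bases M) #|B :&: F|.

Definition rank (M : matroid) : nat := rk M (ground M).

Definition cork (M : matroid) F : nat := rank M - rk M F.

Definition indep (M : matroid) I : bool := [exists B in bases M, I \subset B].

Definition loop (M : matroid) (e : T) : bool :=
  (e \in ground M) && ~~ indep M [set e].

Definition circuits (M : matroid) : {set {set T}} :=
  [set C | minset [pred D : {set T} | (D \subset ground M) && ~~ indep M D] C].

Definition flat (M : matroid) F : bool :=
  (F \subset ground M) && [forall e in ground M :\: F, rk M F < rk M (e |: F)].

Definition cyclic_flat (M : matroid) F : bool :=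
  flat M F && [exists P : {set {set T}}, (P \subset circuits M) && (cover P == F)].

Lemma leq_rk (M : matroid) F B : B \in bases M -> #|B :&: F| <= rk M F.
Proof. by move=> BM; rewrite /rk (bigD1 B) //= leq_maxl. Qed.

Lemma rk_attained (M : matroid) F : exists2 B, B \in bases M & #|B :&: F| = rk M F.
Proof.
have [B0 B0M] := bases_neq0 M.
have M0 : 0 < #|bases M| by apply/card_gt0P; exists B0.
have [B BM E] := eq_bigmax_cond (fun B : {set T} => #|B :&: F|) M0.
by exists B; rewrite // /rk E.
Qed.

(* Bases of [M] meeting [F] in a basis of [M | F]. *)
Definition rk_bases (M : matroid) F : {set {set T}} :=
  [set B in bases M | #|B :&: F| == rk M F].

Definition restr_bases (M : matroid) F : {set {set T}} :=
  [set B :&: F | B in rk_bases M F].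

Definition contr_bases (M : matroid) F : {set {set T}} :=
  [set B :\: F | B in rk_bases M F].

Lemma rk_bases_swap (M : matroid) F B e f :
  B \in rk_bases M F -> e \in B -> e \notin F -> f \notin B ->
  f |: (B :\ e) \in bases M -> f \notin F /\ f |: (B :\ e) \in rk_bases M F.
Proof.
rewrite inE => /andP[BM /eqP rB] eB eF fB B'M.
have [fF|fF] := boolP (f \in F).
  have := leq_rk F B'M.
  rewrite (_ : _ :&: F = f |: (B :&: F)).
    by rewrite cardsU1 rB inE (negPf fB) add1n ltnn.
  apply/setP => z; rewrite !inE; case: eqVneq => [->|] //=.
  by case: (eqVneq z e) => [->|] //=; rewrite (negPf eF) andbF.
split=> //; rewrite inE B'M -rB; apply/eqP; congr #|pred_of_set _|.
apply/setP => z; rewrite !inE; case: (eqVneq z f) => [->|] /=.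
  by rewrite (negPf fF) andbF.
by case: (eqVneq z e) => [->|] //=; rewrite (negPf eF) andbF.
Qed.

Lemma rk_bases_mix (M : matroid) F B1 B2 :
  B1 \in rk_bases M F -> B2 \in rk_bases M F ->
  (B2 :&: F) :|: (B1 :\: F) \in rk_bases M F.
Proof.
move=> B1r B2r; pose P B := (B \in rk_bases M F) && (B :&: F == B2 :&: F).
have P2 : P B2 by rewrite /P B2r eqxx.
case: (@arg_maxnP _ B2 P (fun B => #|B :&: B1|) P2) => B /andP[Br /eqP BF] Bmax.
have sub1 z : z \in B -> z \notin F -> z \in B1.
  move=> zB zF; apply: contraT => z1.
  have BM : B \in bases M by move: Br; rewrite inE => /andP[].
  have B1M : B1 \in bases M by move: B1r; rewrite inE => /andP[].
  have [f [f1 fB fM]] := bases_exchange BM B1M zB z1.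
  have [fF fr] := rk_bases_swap Br zB zF fB fM.
  have : P (f |: (B :\ z)).
    rewrite /P fr -BF; apply/eqP/setP => y; rewrite !inE.
    case: (eqVneq y f) => [->|] /=; first by rewrite (negPf fF) andbF.
    by case: (eqVneq y z) => [->|] //=; rewrite (negPf zF) andbF.
  move/Bmax; rewrite /= (_ : (f |: B :\ z) :&: B1 = f |: (B :&: B1)).
    by rewrite cardsU1 !inE (negPf fB) /= add1n ltnn.
  apply/setP => y; rewrite !inE; case: (eqVneq y f) => [->|] //=.
  by case: (eqVneq y z) => [->|] //=; rewrite (negPf z1) andbF.
have sub2 z : z \in B1 -> z \notin F -> z \in B.
  move=> z1 zF; apply: contraT => zB.
  have BM : B \in bases M by move: Br; rewrite inE => /andP[].
  have B1M : B1 \in bases M by move: B1r; rewrite inE => /andP[].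
  have [f [fB f1 fM]] := bases_exchange B1M BM z1 zB.
  have [fF _] := rk_bases_swap B1r z1 zF f1 fM.
  by rewrite (sub1 f fB fF) in f1.
rewrite (_ : _ :|: _ = B) // -BF; apply/setP => z; rewrite !inE.
have [zF|zF] := boolP (z \in F); rewrite ?andbT ?orbF ?andbF ?orFb //=.
by apply/idP/idP => [/sub2|/sub1]; apply.
Qed.

Lemma restr_axiom M F : matroid_axiom (ground M :&: F) (restr_bases M F).
Proof.
apply: matroid_axiomP.
- have [B BM rB] := rk_attained M F; exists (B :&: F).
  by apply/imsetP; exists B => //; rewrite inE BM rB eqxx.
- move=> _ /imsetP[B + ->]; rewrite inE => /andP[/bases_sub BE _].
  exact: setSI.
- move=> _ _ e /imsetP[B1 B1r ->] /imsetP[B2 B2r ->].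
  rewrite !inE => /andP[e1 eF]; rewrite eF andbT => e2.
  have Br := rk_bases_mix B1r B2r; set B := _ :|: _ in Br.
  have BM : B \in bases M by move: Br; rewrite inE => /andP[].
  have B1M : B1 \in bases M by move: (B1r); rewrite inE => /andP[].
  have eB : e \notin B by rewrite !inE eF (negPf e2).
  have [f [fB f1 fM]] := bases_exchange B1M BM e1 eB.
  have [fF f2] : f \in F /\ f \in B2.
    by move: fB; rewrite !inE (negPf f1) andbF orbF => /andP[].
  exists f; rewrite !inE f2 fF (negPf f1); split=> //.
  apply/imsetP; exists (f |: (B1 :\ e)).
    rewrite inE fM /= (_ : _ :&: F = f |: ((B1 :&: F) :\ e)).
      rewrite cardsU1 !inE (negPf f1) andbF /=.
      move: B1r; rewrite inE => /andP[_ /eqP <-].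
      by rewrite [in eqbRHS](cardsD1 e) inE e1 eF.
    by apply/setP => z; rewrite !inE; case: (eqVneq z f) => [->|] //=; rewrite andbA.
  by apply/setP => z; rewrite !inE; case: (eqVneq z f) => [->|] //=; rewrite ?fF ?andbA.
Qed.

Definition restr M F : matroid := Matroid (restr_axiom M F).

Lemma contr_axiom M F : matroid_axiom (ground M :\: F) (contr_bases M F).
Proof.
apply: matroid_axiomP.
- have [B BM rB] := rk_attained M F; exists (B :\: F).
  by apply/imsetP; exists B => //; rewrite inE BM rB eqxx.
- move=> _ /imsetP[B + ->]; rewrite inE => /andP[/bases_sub BE _].
  exact: setSD.
- move=> _ _ e /imsetP[B1 B1r ->] /imsetP[B2 B2r ->].
  rewrite !inE => /andP[eF e1]; rewrite eF /= => e2.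
  have B1M : B1 \in bases M by move: (B1r); rewrite inE => /andP[].
  have B2M : B2 \in bases M by move: (B2r); rewrite inE => /andP[].
  have [f [f2 f1 fM]] := bases_exchange B1M B2M e1 e2.
  have [fF fr] := rk_bases_swap B1r e1 eF f1 fM.
  exists f; rewrite !inE f2 fF (negPf f1); split=> //.
  apply/imsetP; exists (f |: (B1 :\ e)) => //.
  apply/setP => z; rewrite !inE; case: (eqVneq z f) => [->|] //=.
    by rewrite fF.
  by case: (z == e); rewrite ?andbF.
Qed.

Definition contr M F : matroid := Matroid (contr_axiom M F).

Definition dsum_bases (M N : matroid) : {set {set T}} :=
  [set B1 :|: B2 | B1 in bases M, B2 in bases N].

Lemma dsum_axiom (M N : matroid) :
  [disjoint ground M & ground N] ->
  matroid_axiom (ground M :|: ground N) (dsum_bases M N).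
Proof.
move=> dis.
have dM B z : B \in bases M -> z \in ground N -> z \notin B.
  move=> /bases_sub BM zN; apply: contraL zN => zB.
  by rewrite (disjointFr dis) // (subsetP BM).
have dN B z : B \in bases N -> z \in ground M -> z \notin B.
  move=> /bases_sub BN zM; apply: contraL zM => zB.
  by rewrite (disjointFl dis) // (subsetP BN).
apply: matroid_axiomP.
- have [B1 B1M] := bases_neq0 M; have [B2 B2N] := bases_neq0 N.
  by exists (B1 :|: B2); apply/imset2P; exists B1 B2.
- move=> _ /imset2P[B1 B2 /bases_sub s1 /bases_sub s2 ->]; exact: setUSS.
- move=> _ _ e /imset2P[B1 B2 B1M B2N ->] /imset2P[C1 C2 C1M C2N ->].
  rewrite !inE negb_or => /orP[eB|eB] /andP[e1 e2].
    have [f [f1 f2 fM]] := bases_exchange B1M C1M eB e1.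
    have eE := subsetP (bases_sub B1M) e eB.
    have fE := subsetP (bases_sub C1M) f f1.
    exists f; rewrite !inE f1 (negPf f2) (negPf (dN _ _ B2N fE)); split=> //.
    apply/imset2P; exists (f |: (B1 :\ e)) B2 => //.
    apply/setP => z; rewrite !inE -orbA; congr (_ || _).
    by case: (eqVneq z e) => [->|] //=; rewrite (negPf (dN _ _ B2N eE)).
  have [f [f1 f2 fM]] := bases_exchange B2N C2N eB e2.
  have eE := subsetP (bases_sub B2N) e eB.
  have fE := subsetP (bases_sub C2N) f f1.
  exists f; rewrite !inE f1 (negPf f2) (negPf (dM _ _ B1M fE)) orbT; split=> //.
  apply/imset2P; exists B1 (f |: (B2 :\ e)) => //.
  apply/setP => z; rewrite !inE orbCA; congr (_ || _).
  by case: (eqVneq z e) => [->|] //=; rewrite (negPf (dM _ _ B1M eE)).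
Qed.

Definition dsum (M N : matroid) (dis : [disjoint ground M & ground N]) : matroid :=
  Matroid (dsum_axiom dis).

Definition matroid_connected (M : matroid) : Prop :=
  forall (M1 M2 : matroid) (dis : [disjoint ground M1 & ground M2]),
    M = dsum dis -> ground M1 = set0 \/ ground M2 = set0.

Lemma restr_contr_disjoint M F :
  [disjoint ground (restr M F) & ground (contr M F)].
Proof.
rewrite -setI_eq0; apply/eqP/setP => z; rewrite !inE.
by case: (z \in F); rewrite ?andbF.
Qed.

Definition restr_dsum_contr M F : matroid := dsum (restr_contr_disjoint M F).

End Matroid.

(* The tropical numbers are the elements of [\bar R] other than [-oo].  A
   [tpoint R I] consists of homogeneous coordinates, indexed by [I], of a point
   of tropical projective space of dimension [#|I| - 1]; two of them represent
   the same point when they are related by [proj_eq].  The linear space, the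
   initial matroids, [R0], [Rinf], [sigma0], [sigmainf] and [presentation] below
   are invariant under [proj_eq], and under adding a constant to the finite
   vectors [x : 'I_n -> R], which represent points of R^n/R(1,...,1). *)
Record tpoint (R : realType) (I : finType) := TPoint {
  tcoord :> I -> \bar R;
  tcoord_Ny : forall i, tcoord i != -oo%E;
  tcoord_fin : exists i, tcoord i != +oo%E }.

Definition proj_eq (R : realType) (I : finType) (u v : I -> \bar R) : Prop :=
  exists c : R, forall i, u i = (v i + c%:E)%E.

Definition min_attained_twice (R : realType) (n : nat) (S : {set 'I_n})
    (t : 'I_n -> \bar R) : Prop :=
  exists j k, [/\ j \in S, k \in S, j != k, t j = t k &
                  forall l, l \in S -> (t j <= t l)%E].

Definition dsubset (n d : nat) := {B : {set 'I_n} | #|B| == d}.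

(* Coordinate at a set [B]; the value [+oo] when [#|B| != d] is junk. *)
Definition pcoord (R : realType) (n d : nat) (V : dsubset n d -> \bar R)
    (B : {set 'I_n}) : \bar R := oapp V +oo%E (insub B).

Definition plucker_relations (R : realType) (n d : nat)
    (V : dsubset n d -> \bar R) : Prop :=
  forall A C : {set 'I_n}, #|A|.+1 = d -> #|C| = d.+1 ->
    min_attained_twice (C :\: A)
      (fun j => pcoord V (j |: A) + pcoord V (C :\ j))%E.

Record valuated_matroid (R : realType) (n d : nat) := ValuatedMatroid {
  vpoint :> tpoint R (dsubset n d);
  vpluckerP : plucker_relations vpoint }.

Section Valuated.
Variables (R : realType) (n d : nat).
Implicit Types (V : valuated_matroid R n d) (x : 'I_n -> R) (F : {set 'I_n}).

Lemma pcoord_Ny V B : pcoord V B != -oo%E.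
Proof. by rewrite /pcoord; case: insub => //= b; apply: tcoord_Ny. Qed.

Lemma pcoordE V (b : dsubset n d) : pcoord V (val b) = V b.
Proof. by rewrite /pcoord valK. Qed.

Lemma pcoord_card V B : pcoord V B != +oo%E -> #|B| = d.
Proof. by rewrite /pcoord; case: insubP => [b /eqP|]. Qed.

Lemma plucker_exchange V B1 B2 e :
  pcoord V B1 != +oo%E -> pcoord V B2 != +oo%E -> e \in B1 -> e \notin B2 ->
  exists f, [/\ f \in B2, f \notin B1 &
    (pcoord V (f |: (B1 :\ e)) + pcoord V ((e |: B2) :\ f)
       <= pcoord V B1 + pcoord V B2)%E].
Proof.
move=> V1 V2 e1 e2; have c1 := pcoord_card V1; have c2 := pcoord_card V2.
have cA : #|B1 :\ e|.+1 = d by rewrite -c1 (cardsD1 e B1) e1.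
have cC : #|e |: B2| = d.+1 by rewrite cardsU1 e2 c2.
have [j [k [jS kS jk tjk tmin]]] := vpluckerP V cA cC.
have eS : e \in (e |: B2) :\: (B1 :\ e) by rewrite !inE !eqxx.
have te : (pcoord V (e |: (B1 :\ e)) + pcoord V ((e |: B2) :\ e)
             = pcoord V B1 + pcoord V B2)%E.
  rewrite setD1K //; congr (_ + pcoord _ _)%E; apply/setP => z; rewrite !inE.
  by case: (eqVneq z e) => [->|] //=; rewrite (negPf e2).
have [f [fS fe tf]] : exists f, [/\ f \in (e |: B2) :\: (B1 :\ e), f != e &
    (pcoord V (f |: (B1 :\ e)) + pcoord V ((e |: B2) :\ f)
       <= pcoord V B1 + pcoord V B2)%E].
  rewrite -te; case: (eqVneq j e) => [je|je].
    exists k; split=> //; first by rewrite -je eq_sym.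
    by rewrite -tjk; apply: tmin.
  by exists j; split=> //; apply: tmin.
move: fS; rewrite !inE (negPf fe) /= => /andP[f1 f2].
by exists f.
Qed.

Lemma plucker_exchange_fin V B1 B2 e :
  pcoord V B1 != +oo%E -> pcoord V B2 != +oo%E -> e \in B1 -> e \notin B2 ->
  exists f, [/\ f \in B2, f \notin B1 &
    exists v1 v2 u1 u2 : R,
    [/\ pcoord V B1 = v1%:E, pcoord V B2 = v2%:E,
       pcoord V (f |: (B1 :\ e)) = u1%:E, pcoord V ((e |: B2) :\ f) = u2%:E &
       (u1 + u2 <= v1 + v2)%R]].
Proof.
move=> V1 V2 e1 e2; have [f [f2 f1]] := plucker_exchange V1 V2 e1 e2.
set B1' := f |: _; set B2' := _ :\ f.
move: (pcoord_Ny V B1) (pcoord_Ny V B2) (pcoord_Ny V B1') (pcoord_Ny V B2') V1 V2.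
case E1: (pcoord V B1) => [v1| |] //; case E2: (pcoord V B2) => [v2| |] //.
case E3: (pcoord V B1') => [u1| |] //; case E4: (pcoord V B2') => [u2| |] // _ _ _ _ _ _ le.
by exists f; split=> //; exists v1, v2, u1, u2; split.
Qed.

Definition underlying_bases V : {set {set 'I_n}} :=
  [set B : {set 'I_n} | (#|B| == d) && (pcoord V B < +oo)%E].

Lemma underlying_axiom V : matroid_axiom [set: 'I_n] (underlying_bases V).
Proof.
apply: matroid_axiomP.
- have [b bfin] := tcoord_fin V; exists (val b).
  by rewrite inE (valP b) pcoordE ltey.
- by move=> B _; apply: subsetT.
- move=> B1 B2 e; rewrite !inE !ltey => /andP[_ V1] /andP[_ V2] e1 e2.
  have [f [f2 f1 [v1 [v2 [u1 [u2 [_ _ E _ _]]]]]]] :=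
    plucker_exchange_fin V1 V2 e1 e2.
  exists f; split=> //; rewrite inE E ltry andbT.
  by apply/eqP/(@pcoord_card V); rewrite E.
Qed.

Definition underlying V : matroid 'I_n := Matroid (underlying_axiom V).

Definition tilted V x (B : {set 'I_n}) : \bar R :=
  (pcoord V B - (\sum_(i in B) x i)%:E)%E.

Definition initial_bases V x : {set {set 'I_n}} :=
  [set B : {set 'I_n} | (#|B| == d) &&
     [forall B' : {set 'I_n}, (#|B'| == d) ==> (tilted V x B <= tilted V x B')%E]].

Lemma initial_bases_neq0 V x : exists B, B \in initial_bases V x.
Proof.
have [b0 _] := tcoord_fin V.
have [b _ bmin] := @arg_minP _ _ _ b0 xpredT (fun b => tilted V x (val b)) isT.
exists (val b); rewrite inE (valP b) /=; apply/forall_inP => B' cB'.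
exact: bmin (Sub B' cB') isT.
Qed.

Lemma initial_basesP V x B : B \in initial_bases V x ->
  pcoord V B != +oo%E /\
  (forall B' : {set 'I_n}, #|B'| = d -> (tilted V x B <= tilted V x B')%E).
Proof.
rewrite inE => /andP[_ /forall_inP Bmin]; split; last by move=> B' /eqP; apply: Bmin.
have [b bfin] := tcoord_fin V; have := Bmin _ (valP b).
rewrite /tilted pcoordE; apply: contraTneq => ->.
by move: bfin (tcoord_Ny V b); case: (V b).
Qed.

Lemma initial_axiom V x : matroid_axiom [set: 'I_n] (initial_bases V x).
Proof.
apply: matroid_axiomP; [exact: initial_bases_neq0|by move=> B _; apply: subsetT|].
move=> B1 B2 e B1m B2m e1 e2.
have [V1 min1] := initial_basesP B1m; have [V2 min2] := initial_basesP B2m.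
have [f [f2 f1 [v1 [v2 [u1 [u2 [E1 E2 E3 E4 le]]]]]]] :=
  plucker_exchange_fin V1 V2 e1 e2.
exists f; split=> //.
have c1 : #|f |: (B1 :\ e)| = d by apply: (@pcoord_card V); rewrite E3.
have c2 : #|(e |: B2) :\ f| = d by apply: (@pcoord_card V); rewrite E4.
have ef : e != f by apply: contraNneq f1 => <-.
have B2E : (e |: B2) :\ f = e |: (B2 :\ f).
  by apply/setP => z; rewrite !inE; case: (eqVneq z e) => [->|] //=; rewrite ef.
have := min2 _ c2; have := min1 _ c1; rewrite /tilted E1 E2 E3 E4 /= !lee_fin.
have fB1 : f \notin B1 :\ e by rewrite !inE (negPf f1) andbF.
have eB2 : e \notin B2 :\ f by rewrite !inE (negPf e2) andbF.
rewrite B2E (big_setU1 _ fB1) (big_setU1 _ eB2) /=.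
rewrite (big_setD1 e e1) (big_setD1 f f2) /= => le1 le2.
rewrite inE c1 eqxx /=; apply/forall_inP => B' /eqP cB'.
apply: le_trans (min1 _ cB'); rewrite /tilted E1 E3 /= lee_fin.
rewrite (big_setU1 _ fB1) (big_setD1 e e1) /=; lra.
Qed.

Definition initial V x : matroid 'I_n := Matroid (initial_axiom V x).

Definition initial_matroids V (M : matroid 'I_n) : Prop :=
  (exists x, M = initial V x) /\ (forall e, loop M e -> loop (underlying V) e).

Definition relint_L V (N : matroid 'I_n) x : Prop := initial V x = N.

Implicit Type y : tpoint R 'I_n.

Definition trop_linear_space V y : Prop :=
  forall C : {set 'I_n}, #|C| = d.+1 ->
    min_attained_twice C (fun j => y j + pcoord V (C :\ j))%E.

Definition relsupp x y : {set 'I_n} :=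
  [set j | [exists k, (y k - (x k)%:E < y j - (x j)%:E)%E]].

Definition R0 V F x y : Prop := trop_linear_space V y /\ F \subset relsupp x y.

(* Here [initial V x] is the only matroid [M] such that [relint_L V M x]. *)
Definition Rinf V F x y : Prop :=
  forall z, relint_L V (restr_dsum_contr (initial V x) F) z -> R0 V F z y.

(* A multiset of [d] points is given as a family indexed by ['I_d], the order
   being irrelevant to everything below. *)
Implicit Type A : 'I_d -> tpoint R 'I_n.

Definition sigma0 V A F x : nat := #|[set i | `[< R0 V F x (A i) >]]|.

Definition sigmainf V A F x : nat := #|[set i | `[< Rinf V F x (A i) >]]|.

Definition stiefel A (B : dsubset n d) : \bar R :=
  \big[Order.min/+oo%E]_(j : {ffun 'I_d -> 'I_n} | [set j i | i : 'I_d] == val B)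
     (\sum_i A i (j i))%E.

Definition presentation A V : Prop := proj_eq (stiefel A) V.

End Valuated.

(* Main.v *)
Require Import Defs.
From mathcomp Require Import all_boot all_order all_algebra.
From mathcomp Require Import lra boolp reals constructive_ereal.

(* Write V^x for the initial matroid at x, and call a matching of the rows of A
   to distinct columns tight at x if every row i is sent to a column at which
   A_i - x is minimal.

   If A presents V, then at a point z where V^z has no coloop every optimal
   matching is tight: were row i cheaper at column j, take an optimal matching
   avoiding j, superpose it on the one with i moved to j, and split the sum,
   a graph of maximal degree two, into two matchings, one of which would be too
   cheap. When F is a separator of V^z, counting columns in F in the same split
   shows that a tight column of row i lies in F exactly when the matched one
   does. So the rows matched outside F are those whose minima all lie outside F,
   for all z in the relative interior at once.

   Conversely, condition (1) is Hall's condition for the tight graph at x, so the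
   Stiefel image agrees with V up to a constant on the bases of V^x. A maximal
   initial matroid is connected, since any separator gives a direction in which
   to enlarge it; hence two bases of V differing by one exchange lie in a common
   connected V^x, and the constant is global. For a non-basis B take F, a cyclic
   flat of the underlying matroid with more than rk F elements in B, and a
   connected V^x having a facet in the corresponding facet of the matroid polytope
   of V. The relative interior of the cell of that facet is unbounded in
   direction e_F, so by (2) all but rk F rows are infinite on F and none of the
   matchings onto B is finite. *)

Set Implicit Arguments.
Unset Strict Implicit.
Unset Printing Implicit Defensive.
Import Order.TTheory GRing.Theory Num.Theory.

Local Open Scope nat_scope.

(** * Matroids *)

Section MatroidTheory.
Variable T : finType.
Implicit Types (M N : matroid T) (B F S : {set T}).

Lemma bases_card M B1 B2 :
  B1 \in bases M -> B2 \in bases M -> #|B1| = #|B2|.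
Proof.
have [m] := ubnP #|B1 :\: B2|; elim: m B1 => // m IH B1 lem B1M B2M.
have [s12|/subsetPn[e e1 e2]] := boolP (B1 \subset B2).
  have [s21|/subsetPn[e e2 e1]] := boolP (B2 \subset B1).
    by congr #|pred_of_set _|; apply/eqP; rewrite eqEsubset s12.
  have [f [f1 f2 _]] := bases_exchange B2M B1M e2 e1.
  by rewrite (subsetP s12 f f1) in f2.
have [f [f2 f1 fM]] := bases_exchange B1M B2M e1 e2.
have fe : f \notin B1 :\ e by rewrite !inE (negPf f1) andbF.
have <- : #|f |: (B1 :\ e)| = #|B1| by rewrite cardsU1 fe (cardsD1 e B1) e1.
apply: IH => //; move: lem; rewrite ltnS; apply: leq_trans; apply: proper_card.
apply/properP; split.
  apply/subsetP => z; rewrite !inE => /andP[z2].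
  by case: (eqVneq z f) z2 => [->|_ z2 /andP[_ ->]]; rewrite ?f2 // z2.
by exists e; rewrite !inE ?e1 ?e2 // eqxx; case: eqVneq e1 f1 => // -> ->.
Qed.

(** Parts inside and outside [F] of bases attaining the rank of [F] recombine freely, by
    [rk_bases_mix]. The direct sum can thus be handled as a subfamily of the bases of [M]. *)
Lemma restr_dsum_contr_bases M F : bases (restr_dsum_contr M F) = rk_bases M F.
Proof.
apply/setP => B; apply/idP/idP.
  move=> /imset2P[_ _ /imsetP[B2 B2r ->] /imsetP[B1 B1r ->] ->].
  exact: rk_bases_mix.
move=> Br; apply/imset2P; exists (B :&: F) (B :\: F).
- by apply/imsetP; exists B.
- by apply/imsetP; exists B.
- by rewrite setID.
Qed.

Lemma restr_dsum_contr_ground M F : ground (restr_dsum_contr M F) = ground M.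
Proof. by rewrite /= setID. Qed.

(** If all bases meet [S] equally often, all of them attain its rank, so [M] is the direct sum of
    [M|S] and [M/S]. This counting form of a separator is the one used throughout. *)
Lemma connected_split M S r : matroid_connected M ->
  (forall B, B \in bases M -> #|B :&: S| = r) ->
  ground M :&: S = set0 \/ ground M :\: S = set0.
Proof.
move=> Mconn MS; apply: (Mconn _ _ (restr_contr_disjoint M S)).
apply: matroid_inj; first by rewrite [RHS]restr_dsum_contr_ground.
rewrite [RHS]restr_dsum_contr_bases; apply/setP => B; rewrite inE.
case BM: (B \in bases M) => //=; have [B' B'M <-] := rk_attained M S.
by rewrite !MS ?eqxx.
Qed.

Lemma disconnected_split M : ~ matroid_connected M ->
  exists S r, [/\ S \subset ground M, S != set0, ground M :\: S != set0 &
    forall B, B \in bases M -> #|B :&: S| = r].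
Proof.
move=> /existsNP[M1 /existsNP[M2 /existsNP[dis /not_implyP[ME]]]].
move=> /not_orP[/eqP M1n /eqP M2n].
have [B0 B0M] := bases_neq0 M1.
exists (ground M1), #|B0|; rewrite ME /=; split=> //; first exact: subsetUl.
  case/set0Pn: M2n => z z2; apply/set0Pn; exists z.
  by rewrite !inE z2 orbT andbT (disjointFl dis).
move=> _ /imset2P[B1 B2 B1M B2M ->]; rewrite -(bases_card B1M B0M).
congr #|pred_of_set _|; rewrite setIUl (setIidPl (bases_sub B1M)).
apply/setUidPl/subsetP => z /setIP[/(subsetP (bases_sub B2M)) z2 z1].
by rewrite (disjointFr dis z1) in z2.
Qed.

Lemma rank_card M B : B \in bases M -> rank M = #|B|.
Proof.
move=> BM; rewrite /rank; have [B' B'M <-] := rk_attained M (ground M).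
by rewrite (setIidPl (bases_sub B'M)); apply: bases_card BM.
Qed.

Lemma rk_sub M S F : S \subset F -> rk M S <= rk M F.
Proof.
move=> sSF; have [B BM <-] := rk_attained M S.
by apply: leq_trans (leq_rk F BM); apply/subset_leq_card/setIS.
Qed.

(** * Rank-attaining bases and cyclic flats *)

(** Let [B1] attain the rank of [F]. A basis containing [S] that overlaps [B1] most has all its
    elements outside [F] in [B1], since an exchange would enlarge the overlap; as bases have equal
    size, it meets [F] as often as [B1] does. *)
Lemma indep_rk_basis M S F : indep M S -> S \subset F ->
  exists2 B, B \in rk_bases M F & S \subset B.
Proof.
move=> /exists_inP[B0 B0M sB0] sSF.
have [B1 B1M B1r] := rk_attained M F.
have P0 : (B0 \in bases M) && (S \subset B0) by rewrite B0M.
case: (@arg_maxnP _ B0 (fun B => (B \in bases M) && (S \subset B))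
         (fun B => #|B :&: B1|) P0) => B /andP[BM sB] Bmax.
exists B => //; rewrite inE BM /= -B1r eqn_leq; apply/andP; split.
  by rewrite B1r leq_rk.
have : #|B :\: F| <= #|B1 :\: F|.
  apply/subset_leq_card/subsetP => e; rewrite !inE => /andP[eF eB]; rewrite eF /=.
  apply: contraT => e1.
  have [f [f1 fB fM]] := bases_exchange BM B1M eB e1.
  have : (f |: (B :\ e) \in bases M) && (S \subset f |: (B :\ e)).
    rewrite fM /=; apply/subsetP => z zS; rewrite !inE (subsetP sB) // andbT.
    by case: (eqVneq z e) zS => [->|_ _]; rewrite ?orbT // => /(subsetP sSF); rewrite (negPf eF).
  move/Bmax; rewrite /= (_ : _ :&: B1 = f |: (B :&: B1)).
    by rewrite cardsU1 !inE (negPf fB) add1n ltnn.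
  apply/setP => y; rewrite !inE; case: (eqVneq y f) => [->|] //=.
  by case: (eqVneq y e) => [->|] //=; rewrite (negPf e1) andbF.
have E : #|B :&: F| + #|B :\: F| = #|B1 :&: F| + #|B1 :\: F|.
  by rewrite !cardsID; apply: bases_card BM B1M.
by move=> le; rewrite -(leq_add2r #|B1 :\: F|) -E leq_add2l.
Qed.

(** For a circuit [C] in [F] through [f], extend [C :\ f] to a basis attaining the rank of [F]; it
    cannot contain [f] as well. *)
Lemma cyclic_flat_avoid M F f : cyclic_flat M F -> f \in F ->
  exists2 B, B \in rk_bases M F & f \notin B.
Proof.
move=> /andP[_ /existsP[P /andP[PC /eqP PF]]] fF.
have /bigcupP[C CP fC] : f \in cover P by rewrite PF.
have CF : C \subset F by rewrite -PF; apply: bigcup_sup CP.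
move: (subsetP PC _ CP); rewrite inE => /minsetP[/andP[CE Cdep] Cmin].
have Ci : indep M (C :\ f).
  apply: contraT => Cf; have /Cmin/(_ (subD1set _ _)) E :
    [pred D : {set T} | (D \subset ground M) && ~~ indep M D] (C :\ f).
    by rewrite /= Cf andbT (subset_trans (subD1set _ _)).
  by move: fC; rewrite -E !inE eqxx.
have [B Br sB] := indep_rk_basis Ci (subset_trans (subD1set _ _) CF).
exists B => //; apply/negP => fB; case/negP: Cdep; apply/exists_inP; exists B.
  by move: Br; rewrite inE => /andP[].
apply/subsetP => z zC; have [->//|zf] := eqVneq z f.
by apply: (subsetP sB); rewrite !inE zf.
Qed.

(** A basis through [e] outside [F] shows that adding [e] raises the rank. A basis [B] avoiding [f]
    in [F] makes [f |: (B :&: F)] dependent, and its circuit must pass through [f]. *)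
Lemma cyclic_flatI M F : F \subset ground M ->
  (forall f, f \in F -> exists2 B, B \in rk_bases M F & f \notin B) ->
  (forall e, e \in ground M :\: F -> exists2 B, B \in rk_bases M F & e \in B) ->
  cyclic_flat M F.
Proof.
move=> FE avoid cover_; apply/andP; split.
  rewrite /flat FE /=; apply/forall_inP => e eE; have [B Br eB] := cover_ e eE.
  move: Br eE; rewrite !inE => /andP[BM /eqP <-] /andP[eF _].
  apply: leq_trans (leq_rk _ BM).
  rewrite (_ : B :&: (e |: F) = e |: (B :&: F)) ?cardsU1 ?inE ?(negPf eF) ?andbF //.
  by apply/setP => z; rewrite !inE; case: (eqVneq z e) => [->|] //=; rewrite eB.
apply/existsP; exists [set C in circuits M | C \subset F]; apply/andP; split.
  by apply/subsetP => C; rewrite inE => /andP[].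
rewrite eqEsubset; apply/andP; split.
  by apply/bigcupsP => C; rewrite inE => /andP[].
apply/subsetP => f fF; have [B Br fB] := avoid f fF.
move: (Br); rewrite inE => /andP[BM /eqP rB].
have Dsub : f |: (B :&: F) \subset F by rewrite subUset sub1set fF subsetIr.
have dep : [pred D : {set T} | (D \subset ground M) && ~~ indep M D] (f |: (B :&: F)).
  rewrite /= (subset_trans Dsub FE) /=; apply/exists_inP => -[B' B'M sB'].
  have := leq_rk F B'M; rewrite -rB leqNgt => /negP; apply.
  have <- : #|f |: (B :&: F)| = #|B :&: F|.+1 by rewrite cardsU1 !inE (negPf fB).
  by apply/subset_leq_card; rewrite subsetI sB'.
have [C Cmin CD] := minset_exists dep.
apply/bigcupP; exists C; first by rewrite !inE Cmin (subset_trans CD Dsub).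
apply: contraT => fC; have /minsetP[/andP[_ Cdep] _] := Cmin; case/negP: Cdep.
apply/exists_inP; exists B => //; apply/subsetP => z zC.
by move: (subsetP CD z zC); rewrite !inE; case: eqVneq zC fC => [-> ->|_ _ _ /andP[]].
Qed.

Lemma rk_bases_avoid M F B0 e : B0 \in bases M -> e \notin B0 -> e \notin F ->
  exists2 B, B \in rk_bases M F & e \notin B.
Proof.
move=> B0M e0 eF; have [B BM rB] := rk_attained M F.
have Br : B \in rk_bases M F by rewrite inE BM rB eqxx.
have [eB|eB] := boolP (e \in B); last by exists B.
have [f [f0 fB fM]] := bases_exchange BM B0M eB e0.
have [fF fr] := rk_bases_swap Br eB eF fB fM.
by exists (f |: (B :\ e)); rewrite // !inE eqxx; case: eqVneq eB fB => // -> ->.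
Qed.

Lemma connected_avoid M e : matroid_connected M -> e \in ground M ->
  (exists2 B, B \in bases M & e \notin B) \/ ground M = [set e].
Proof.
move=> Mconn eE; have [?|Me] := pselect (exists2 B, B \in bases M & e \notin B);
  [by left|right].
have Mr B : B \in bases M -> #|B :&: [set e]| = 1.
  move=> BM; rewrite (_ : _ :&: _ = [set e]) ?cards1 //; apply/setIidPr.
  by rewrite sub1set; apply: contra_notT Me => eB; exists B.
have [/setP/(_ e)|/eqP] := connected_split Mconn Mr; first by rewrite !inE eE eqxx.
by rewrite setD_eq0 => s; apply/eqP; rewrite eqEsubset s sub1set.
Qed.

Lemma connected_cover M e : matroid_connected M -> e \in ground M ->
  (exists2 B, B \in bases M & e \in B) \/ ground M = [set e].
Proof.
move=> Mconn eE; have [?|Me] := pselect (exists2 B, B \in bases M & e \in B);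
  [by left|right].
have Mr B : B \in bases M -> #|B :&: [set e]| = 0.
  move=> BM; apply/eqP; rewrite cards_eq0 setI_eq0 disjoint_sym disjoints1.
  by apply: contra_notN Me => eB; exists B.
have [/setP/(_ e)|/eqP] := connected_split Mconn Mr; first by rewrite !inE eE eqxx.
by rewrite setD_eq0 => s; apply/eqP; rewrite eqEsubset s sub1set.
Qed.

(** Among the sets violating the rank bound for [S], take one of least rank and then of largest
    size. Removing a coloop of [M|F] lowers the rank by one and the intersection with [S] by at most
    one; adding a loop of [M/F] keeps the rank. Both would contradict the choice. *)
Lemma dependent_cyclic M S : S \subset ground M -> rk M S < #|S| ->
  exists F, [/\ F \subset ground M, rk M F < #|F :&: S|,
   (forall f, f \in F -> exists2 B, B \in rk_bases M F & f \notin B) &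
   (forall e, e \in ground M :\: F -> exists2 B, B \in rk_bases M F & e \in B)].
Proof.
move=> SE Sdep.
pose P F := (F \subset ground M) && (rk M F < #|F :&: S|).
have P0 : P S by rewrite /P SE setIid.
(* The factor [#|T|.+1] exceeds every [#|~: F|], so the order is lexicographic. *)
case: (@arg_minnP _ S P (fun F => rk M F * #|T|.+1 + #|~: F|) P0) => F.
move=> /andP[FE FS] Fmin; exists F; split=> //.
- move=> f fF; apply: contrapT => Ff.
  have fB B : B \in rk_bases M F -> f \in B.
    by move=> Br; apply: contra_notT Ff => fB; exists B.
  have lt : rk M (F :\ f) < rk M F.
    have [B BM <-] := rk_attained M (F :\ f).
    have := leq_rk F BM; rewrite leq_eqVlt => /orP[/eqP rB|].
      have BfB := fB B; rewrite inE BM rB eqxx in BfB.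
      rewrite -rB; apply: proper_card; apply/properP; split.
        by apply/setIS/subD1set.
      by exists f; rewrite !inE ?eqxx ?andbF // BfB.
    by apply: leq_ltn_trans; apply/subset_leq_card/setIS/subD1set.
  have : P (F :\ f).
    rewrite /P (subset_trans (subD1set _ _) FE) /=.
    rewrite -ltnS; apply: leq_ltn_trans lt _; apply: leq_trans FS _.
    rewrite (cardsD1 f (F :&: S)).
    rewrite (_ : (F :&: S) :\ f = (F :\ f) :&: S) ?setIDAC //.
    by case: (f \in _).
  move=> /Fmin; apply/negP; rewrite -ltnNge.
  apply: (@leq_trans ((rk M (F :\ f)).+1 * #|T|.+1)).
    by rewrite mulSn addnC ltn_add2r ltnS max_card.
  by rewrite (leq_trans _ (leq_addr _ _)) // leq_mul2r lt orbT.
- move=> e /setDP[eE eF]; apply: contrapT => Fe.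
  have eB B : B \in rk_bases M F -> e \notin B.
    by move=> Br; apply: contra_notN Fe => eB; exists B.
  have lt : rk M (e |: F) <= rk M F.
    have [B BM <-] := rk_attained M (e |: F).
    have := leq_rk F BM; rewrite leq_eqVlt => /orP[/eqP rB|].
      have BeB := eB B; rewrite inE BM rB eqxx in BeB; rewrite -rB.
      apply/subset_leq_card/subsetP => z; rewrite !inE => /andP[zB].
      by rewrite zB; case: eqVneq zB (BeB isT) => [-> ->|].
    apply: leq_trans; rewrite -add1n -(cards1 e).
    apply: leq_trans (leq_card_setU _ _); apply/subset_leq_card/subsetP => z.
    by rewrite !inE; case: (z == e) => //=.
  have : P (e |: F).
    rewrite /P subUset sub1set eE FE /=; apply: leq_ltn_trans lt _.
    by apply: leq_trans FS _; apply/subset_leq_card/setSI/subsetUr.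
  move=> /Fmin; apply/negP; rewrite -ltnNge -addnS.
  apply: leq_add; first by rewrite leq_mul2r lt orbT.
  apply: proper_card; apply/properP; split; first by rewrite setCS subsetUr.
  by exists e; rewrite !inE ?eqxx.
Qed.

End MatroidTheory.

(** * Bipartite matchings *)

Section Matchings.
Variables (I J : finType).

(* The graph formed by [mu'] and [nu] has maximal degree two: swapping the two
   functions on a minimal set of rows closed under alternating paths leaving
   [j] splits it into two matchings. *)
Lemma matching_rebalance (mu nu : I -> J) (i : I) (j : J) :
  injective mu -> injective nu -> (forall k, nu k != j) ->
  let mu' k := if k == i then j else mu k in
  exists S : {set I},
    injective (fun k => if k \in S then nu k else mu' k) /\
    injective (fun k => if k \in S then mu' k else nu k).
Proof.
move=> muI nuI nuj mu'.
pose clos (S : {set I}) :=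
  [forall k, (k != i) && (mu k == j) ==> (k \in S)] &&
  [forall k in S, forall l, (mu' l == nu k) ==> (l \in S)].
have closT : clos setT.
  apply/andP; split; first by apply/forallP => k; rewrite inE implybT.
  by apply/forall_inP => k _; apply/forallP => l; rewrite inE implybT.
have [S /minsetP[/andP[/forallP S1 /forall_inP S2] Smin] _] := minset_exists closT.
have S2' k l : k \in S -> mu' l = nu k -> l \in S.
  by move=> kS e; move/forallP: (S2 k kS) => /(_ l); rewrite e eqxx.
(* By minimality every row of [S] has a cause: it competes for [j], or its [mu'] column is the [nu]
   column of a row of [S]. *)
have drop k : k \in S ->
    (k != i) && (mu k == j) \/ exists2 l, l \in S & mu' k = nu l.
  move=> kS; apply: contrapT => /not_orP[/negP k1 k2].
  have /Smin/(_ (subD1set _ _))/setP/(_ k) : clos (S :\ k).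
    apply/andP; split.
      apply/forallP => l; apply/implyP => h; rewrite !inE (implyP (S1 l) h) andbT.
      by apply: contraNneq k1 => <-.
    apply/forall_inP => l /setD1P[lk lS]; apply/forallP => m; apply/implyP => /eqP h.
    rewrite !inE (S2' _ _ lS h) andbT; apply/eqP => mk; apply: k2.
    by exists l; rewrite // -mk.
  by rewrite !inE eqxx kS.
have iS : i \notin S.
  apply/negP => /drop[|[l _]]; first by rewrite eqxx.
  by rewrite /mu' eqxx => /esym/eqP; rewrite (negPf (nuj l)).
exists S; split=> k l.
- case: ifP => kS; case: ifP => lS.
  + exact: nuI.
  + by move=> /esym/(S2' _ _ kS); rewrite lS.
  + by move=> /(S2' _ _ lS); rewrite kS.
  + rewrite /mu'; case: (eqVneq k i) => [->|ki]; case: (eqVneq l i) => [->|li] //.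
    * by move=> /esym/eqP h; have := S1 l; rewrite li h lS.
    * by move=> /eqP h; have := S1 k; rewrite ki h kS.
    * exact: muI.
- case: ifP => kS; case: ifP => lS.
  + rewrite /mu'; case: (eqVneq k i) => [ki|_]; first by rewrite -ki kS in iS.
    by case: (eqVneq l i) => [li|_]; [rewrite -li lS in iS|apply: muI].
  + move=> e; case: (drop k kS) => [/andP[ki /eqP kj]|[m mS em]].
      by have := nuj l; rewrite -e /mu' (negPf ki) kj eqxx.
    by rewrite e in em; move: lS; rewrite (nuI _ _ em) mS.
  + move=> e; case: (drop l lS) => [/andP[li /eqP lj]|[m mS em]].
      by have := nuj k; rewrite e /mu' (negPf li) lj eqxx.
    by rewrite -e in em; move: kS; rewrite (nuI _ _ em) mS.
  + exact: nuI.
Qed.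

(* Rado's argument: in a family satisfying Hall's condition and minimal for it
   every member is a singleton. *)
Lemma hall (D : {set J}) (N : {ffun J -> {set I}}) :
  (forall S : {set J}, S \subset D -> #|S| <= #|\bigcup_(b in S) N b|) ->
  exists g : {ffun J -> option I},
    {in D, forall b, exists2 i, g b = Some i & i \in N b} /\ {in D &, injective g}.
Proof.
pose w (N : {ffun J -> {set I}}) := \sum_(b in D) #|N b|.
have [m] := ubnP (w N); elim: m N => // m IH N wm hallN.
have ge1 b : b \in D -> 0 < #|N b|.
  move=> bD; have := hallN [set b]; rewrite sub1set bD cards1 big_set1; exact.
have [/forall_inP sing|] := boolP [forall b in D, #|N b| <= 1].
  exists [ffun b => [pick i in N b]]; split.
    move=> b bD; rewrite ffunE; case: pickP => [i iN|N0]; first by exists i.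
    by move: (ge1 b bD); rewrite (eq_card0 N0).
  move=> b c bD cD; rewrite !ffunE.
  case: pickP => [i iN|N0]; last by move: (ge1 b bD); rewrite (eq_card0 N0).
  case: pickP => [k kN|N0]; last by move: (ge1 c cD); rewrite (eq_card0 N0).
  move=> [ik]; apply/eqP; apply: contraT => bc; rewrite -{}ik in kN.
  have single d : d \in D -> i \in N d -> N d = [set i].
    move=> dD iNd; apply/esym/eqP; rewrite eqEcard sub1set iNd cards1.
    exact: sing.
  have := hallN [set b; c]; rewrite subUset !sub1set bD cD cards2 bc.
  by rewrite bigcup_setU !big_set1 (single b) // (single c) // setUid cards1 => /(_ isT).
rewrite negb_forall_in => /exists_inP[b bD]; rewrite -ltnNge => /card_gt1P.
move=> [i1 [i2 [iN1 iN2 i12]]].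
pose N' i := [ffun c => if c == b then N b :\ i else N c].
(* If deleting [i] from [N b] breaks Hall's condition, a violating set contains [b]; the set
   returned is the rest of it. *)
have step i : i \in N b -> ~ (forall S : {set J}, S \subset D ->
    #|S| <= #|\bigcup_(c in S) N' i c|) ->
    exists S : {set J}, [/\ S \subset D, b \notin S &
      #|(\bigcup_(c in S) N c) :|: (N b :\ i)| <= #|S|].
  move=> iN /existsNP[S /not_implyP[SD /negP]]; rewrite -ltnNge => lt.
  have bS : b \in S.
    apply: contraTT lt => bS; rewrite -leqNgt; apply: leq_trans (hallN S SD) _.
    rewrite (eq_bigr (N' i)) // => c cS; rewrite ffunE.
    by case: eqVneq cS bS => // -> ->.
  exists (S :\ b); split; rewrite ?inE ?eqxx //.
    exact: subset_trans (subD1set _ _) SD.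
  move: lt; rewrite (cardsD1 b S) bS add1n ltnS; apply: leq_trans.
  rewrite (big_setD1 b bS) /= ffunE eqxx setUC.
  rewrite (eq_bigr (N' i)) // => c /setD1P[cb _].
  by rewrite ffunE (negPf cb).
have done_ i : i \in N b ->
  (forall S : {set J}, S \subset D -> #|S| <= #|\bigcup_(c in S) N' i c|) ->
  exists g : {ffun J -> option I},
    {in D, forall b, exists2 i, g b = Some i & i \in N b} /\ {in D &, injective g}.
  move=> iN hallN'; case: (IH (N' i)) => //.
    move: wm; rewrite ltnS; apply: leq_trans; rewrite /w !(bigD1 b bD) /= ffunE eqxx.
    rewrite (cardsD1 i (N b)) iN addSn ltnS leq_add2l leq_eqVlt.
    rewrite (eq_bigr (fun c => #|N c|)) ?eqxx // => c /andP[_ cb].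
    by rewrite ffunE (negPf cb).
  move=> g [gN gI]; exists g; split=> // c cD; have [i' gi i'N] := gN c cD.
  exists i' => //; move: i'N; rewrite ffunE; case: eqVneq => [->|//].
  by move/setD1P => [].
have [h1|/(step _ iN1)[S1 [S1D bS1 le1]]] := pselect (forall S : {set J},
  S \subset D -> #|S| <= #|\bigcup_(c in S) N' i1 c|); first exact: done_ h1.
have [h2|/(step _ iN2)[S2 [S2D bS2 le2]]] := pselect (forall S : {set J},
  S \subset D -> #|S| <= #|\bigcup_(c in S) N' i2 c|); first exact: done_ h2.
exfalso; set U1 := _ :|: _ in le1; set U2 := _ :|: _ in le2.
(* Together the two deletions lose nothing of [N b], as [i1] and [i2] differ. Hall's condition for
   [b |: (S1 :|: S2)] and for the intersection then contradicts [le1] and [le2] by modularity of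
   cardinality. *)
have leU : #|S1 :|: S2|.+1 <= #|U1 :|: U2|.
  have := hallN (b |: (S1 :|: S2)).
  rewrite !subUset sub1set bD S1D S2D cardsU1 !inE negb_or bS1 bS2 => /(_ isT).
  move/leq_trans; apply; apply/subset_leq_card/bigcupsP => c.
  rewrite !inE => /orP[/eqP->|/orP[c1|c2]]; apply/subsetP => z zN.
  - rewrite !inE zN !andbT; case: (eqVneq z i1) => [->|]; rewrite ?orbT //=.
    by rewrite (negPf (i12)) /= ?orbT.
  - by rewrite !inE; apply/orP; left; apply/orP; left; apply/bigcupP; exists c.
  - by rewrite !inE; apply/orP; right; apply/orP; left; apply/bigcupP; exists c.
have leI : #|S1 :&: S2| <= #|U1 :&: U2|.
  apply: leq_trans (hallN _ _) _; first by rewrite subIset // S1D.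
  apply/subset_leq_card/bigcupsP => c /setIP[c1 c2]; apply/subsetP => z zN.
  by rewrite !inE; apply/andP; split; apply/orP; left; apply/bigcupP; exists c.
have := leq_add leU leI; rewrite addSn !cardsUI ltnNge.
by rewrite (leq_add le1 le2).
Qed.

End Matchings.

(** * Initial matroids of a valuated matroid *)

Section InitialMatroids.
Variables (R : realType) (n d : nat) (V : valuated_matroid R n d).
Implicit Types (x u : 'I_n -> R) (B F S : {set 'I_n}).
Local Open Scope ring_scope.

(** Real-valued form of [tilted]. As [fine] sends +oo to 0, it is meaningful only on bases of the
    underlying matroid. *)
Definition weight x B : R := fine (pcoord V B) - \sum_(i in B) x i.

Lemma underlyingE B : (B \in underlying_bases V) = (pcoord V B != +oo%E).
Proof.
rewrite inE ltey; case: eqVneq => [_|]; rewrite ?andbF // => cB.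
by apply/esym/negbTE; apply: contraNN cB => /pcoord_card ->.
Qed.

Lemma underlying_card B : B \in underlying_bases V -> #|B| = d.
Proof. by rewrite inE => /andP[/eqP]. Qed.

Lemma underlying_fin B : B \in underlying_bases V ->
  pcoord V B = (fine (pcoord V B))%:E.
Proof.
rewrite underlyingE => Bfin; rewrite fineK // fin_numE Bfin andbT.
exact: pcoord_Ny.
Qed.

Lemma initialP x B :
  reflect (B \in underlying_bases V /\
           forall B', B' \in underlying_bases V -> weight x B <= weight x B')
          (B \in initial_bases V x).
Proof.
apply: (iffP idP) => [Bm|[Bu Bmin]].
  have [Bfin Bmin] := initial_basesP Bm.
  have Bu : B \in underlying_bases V by rewrite underlyingE.
  split=> // B' B'u; have := Bmin _ (underlying_card B'u).
  by rewrite /tilted (underlying_fin Bu) (underlying_fin B'u) lee_fin.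
rewrite inE (underlying_card Bu) eqxx; apply/forall_inP => B' /eqP cB'.
have [B'u|] := boolP (B' \in underlying_bases V).
  by rewrite /tilted (underlying_fin Bu) (underlying_fin B'u) lee_fin Bmin.
by rewrite underlyingE negbK => /eqP B'oo; rewrite /tilted B'oo /= leey.
Qed.

Lemma initial_underlying x B : B \in initial_bases V x -> B \in underlying_bases V.
Proof. by case/initialP. Qed.

Lemma initial_card x B : B \in initial_bases V x -> #|B| = d.
Proof. by move/initial_underlying/underlying_card. Qed.

Lemma initial_min x B B' : B \in initial_bases V x ->
  B' \in underlying_bases V -> weight x B <= weight x B'.
Proof. by case/initialP => _; apply. Qed.

Lemma initial_eq x B B' : B \in initial_bases V x -> B' \in initial_bases V x ->
  weight x B = weight x B'.
Proof.
move=> Bm B'm; apply/eqP; rewrite eq_le.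
by rewrite !initial_min ?(initial_underlying Bm) ?(initial_underlying B'm).
Qed.

Lemma initial_lt x B B' : B \in initial_bases V x ->
  B' \in underlying_bases V -> B' \notin initial_bases V x ->
  weight x B < weight x B'.
Proof.
move=> Bm B'u; apply: contraNT; rewrite -leNgt => le; apply/initialP; split=> //.
by move=> C Cu; apply: le_trans le (initial_min Bm Cu).
Qed.

Lemma initial_le x B B' : B \in initial_bases V x ->
  B' \in underlying_bases V -> weight x B' <= weight x B ->
  B' \in initial_bases V x.
Proof.
move=> Bm B'u; apply: contraTT => B'm; rewrite -ltNge; exact: initial_lt.
Qed.

(** * Enlarging initial matroids by moving the point *)

Definition translate x (t : R) u : 'I_n -> R := fun i => x i + t * u i.

Definition indicator S : 'I_n -> R := fun i => (i \in S)%:R.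

Lemma weight_translate x t u B :
  weight (translate x t u) B = weight x B - t * \sum_(i in B) u i.
Proof. by rewrite /weight big_split -mulr_sumr opprD addrA. Qed.

Lemma sum_indicator S B : \sum_(i in B) indicator S i = #|B :&: S|%:R.
Proof.
rewrite -sum1_card natr_sum (big_mkcond (fun i => i \in B)) [RHS]big_mkcond.
by apply: eq_bigr => i _; rewrite inE /indicator; do 2 case: (_ \in _).
Qed.

Lemma weight_indicator x t S B :
  weight (translate x t (indicator S)) B = weight x B - t * #|B :&: S|%:R.
Proof. by rewrite weight_translate sum_indicator. Qed.

Lemma initial_enlarge x S r :
  (forall B, B \in initial_bases V x -> #|B :&: S| = r) ->
  (exists2 B, B \in underlying_bases V & (r < #|B :&: S|)%N) ->
  exists x', initial_bases V x \proper initial_bases V x' /\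
    forall B, B \in initial_bases V x' -> B \notin initial_bases V x ->
      (r < #|B :&: S|)%N.
Proof.
move=> xS [B1 B1u B1S]; have [B0 B0m] := initial_bases_neq0 V x.
pose P B := (B \in underlying_bases V) && (r < #|B :&: S|)%N.
(* The time at which [B] ties with [B0]. *)
pose g B := (weight x B - weight x B0) / (#|B :&: S|%:R - r%:R).
have P1 : P B1 by rewrite /P B1u.
case: (@Order.TotalTheory.arg_minP _ _ _ B1 P g P1) => B2 /andP[B2u B2S] gmin.
set t := g B2 in gmin.
have den B : (r < #|B :&: S|)%N -> 0 < #|B :&: S|%:R - r%:R :> R.
  by move=> lt; rewrite subr_gt0 ltr_nat.
have t0 : 0 <= t.
  by rewrite divr_ge0 ?(ltW (den _ B2S)) // subr_ge0 (initial_min B0m).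
pose x' := translate x t (indicator S).
have wB0 : weight x' B0 = weight x B0 - t * r%:R by rewrite weight_indicator xS.
have up B : B \in underlying_bases V -> weight x' B0 <= weight x' B.
  move=> Bu; rewrite wB0 weight_indicator.
  have [BS|BS] := ltnP r #|B :&: S|.
    have := gmin B; rewrite /P Bu BS => /(_ isT).
    rewrite ler_pdivlMr ?den //; lra.
  have : t * #|B :&: S|%:R <= t * r%:R by rewrite ler_wpM2l // ler_nat.
  have := initial_min B0m Bu; lra.
have B0m' : B0 \in initial_bases V x'.
  by apply/initialP; split=> //; apply: initial_underlying B0m.
exists x'; split.
  apply/properP; split.
    apply/subsetP => B Bm; apply: (initial_le B0m' (initial_underlying Bm)).
    by rewrite wB0 weight_indicator xS // (initial_eq Bm B0m).
  exists B2; last by apply: contraTN B2S => /xS ->; rewrite ltnn.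
  apply: (initial_le B0m' B2u); rewrite wB0 weight_indicator.
  have : t * (#|B2 :&: S|%:R - r%:R) = weight x B2 - weight x B0.
    by rewrite /t /g divfK // gt_eqF // den.
  lra.
move=> B Bm' Bm; rewrite ltnNge; apply: contraNN Bm => BS.
apply: (initial_le B0m (initial_underlying Bm')).
have := initial_eq Bm' B0m'; rewrite wB0 weight_indicator.
have : t * #|B :&: S|%:R <= t * r%:R by rewrite ler_wpM2l // ler_nat.
lra.
Qed.

Lemma exists_maximal_initial (P Q : ('I_n -> R) -> Prop) x0 :
  (forall x, P x -> ~ Q x ->
     exists x', P x' /\ initial_bases V x \proper initial_bases V x') ->
  P x0 ->
  exists x, [/\ P x, Q x & initial_bases V x0 \subset initial_bases V x].
Proof.
move=> step; have [m] := ubnP #|~: initial_bases V x0|.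
elim: m x0 => // m IH x0 lem P0.
have [Q0|/(step _ P0)[x1 [P1 lt01]]] := pselect (Q x0); first by exists x0.
have [||x [Px Qx s1x]] := IH x1 => //.
  move: lem; rewrite ltnS; apply: leq_trans; apply: proper_card.
  by rewrite properC.
by exists x; split=> //; apply: subset_trans s1x; apply: proper_sub.
Qed.

(** A separator of [V^x] does not separate the underlying matroid, so some basis meets it in another
    number of elements, and the initial matroid can be enlarged. This ends, as there are finitely
    many sets. *)
Lemma connected_extension x : matroid_connected (underlying V) ->
  exists2 x', matroid_connected (initial V x') &
    initial_bases V x \subset initial_bases V x'.
Proof.
move=> Vconn.
have [||x' [_ ? ?]] := @exists_maximal_initial (fun _ => True)
  (fun y => matroid_connected (initial V y)) x => //; last by exists x'.
move=> {}x _ /disconnected_split[S [r [_ Sn0 SCn0 xS]]].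
have enlarge S' r' : (forall B, B \in initial_bases V x -> #|B :&: S'| = r') ->
  (exists2 B, B \in underlying_bases V & (r' < #|B :&: S'|)%N) ->
  exists x', True /\ initial_bases V x \proper initial_bases V x'.
  by move=> h1 h2; have [x' [lt _]] := initial_enlarge h1 h2; exists x'.
have [B Bu BS] : exists2 B, B \in underlying_bases V & #|B :&: S| != r.
  apply: contrapT => none.
  have [] := @connected_split _ (underlying V) S r Vconn.
  - by move=> B Bu; apply/eqP; apply: contra_notT none => ?; exists B.
  - by move/eqP; rewrite setTI (negPf Sn0).
  - by move/eqP; rewrite (negPf SCn0).
have BI B' S' : (#|B' :&: ~: S'| = #|B'| - #|B' :&: S'|)%N.
  by rewrite -setDE cardsD.
(* A basis with too few elements in [S] has too many in the complement, so the move goes along the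
   complement. *)
move: BS; rewrite neq_ltn => /orP[lt|lt]; last by apply: (enlarge S r) => //; exists B.
apply: (enlarge (~: S) (d - r)%N).
  by move=> B' B'm; rewrite BI (xS _ B'm) (initial_card B'm).
exists B => //; rewrite BI (underlying_card Bu); apply: ltn_sub2l => //.
apply: leq_trans lt _; have [B0 B0m] := initial_bases_neq0 V x.
by rewrite -(xS _ B0m) -(initial_card B0m) subset_leq_card // subsetIl.
Qed.

(** * Initial matroids meeting prescribed faces of the matroid polytope *)

Lemma initial_asymptotic x u B0 : B0 \in underlying_bases V ->
  (forall B, B \in underlying_bases V -> \sum_(i in B) u i <= \sum_(i in B0) u i) ->
  exists t, forall B, B \in initial_bases V (translate x t u) ->
    \sum_(i in B) u i = \sum_(i in B0) u i.
Proof.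
move=> B0u B0max; pose s B := \sum_(i in B) u i.
pose g B := (weight x B0 - weight x B) / (s B0 - s B).
(* [g B] is the time after which [B0] beats [B]; the sum exceeds all of these times. *)
exists (1 + \sum_(B : {set 'I_n}) `|g B|) => B Bm.
have Bu := initial_underlying Bm.
apply/eqP; rewrite eq_le (B0max _ Bu) /= leNgt; apply/negP => lt.
have := initial_min Bm B0u; rewrite !weight_translate -/(s B) -/(s B0).
have den : 0 < s B0 - s B by rewrite subr_gt0.
have : g B < 1 + \sum_(B : {set 'I_n}) `|g B|.
  rewrite (bigD1 B) //=.
  have : 0 <= \sum_(i | i != B) `|g i| by apply: sumr_ge0 => *; apply: normr_ge0.
  have := ler_norm (g B); lra.
rewrite {1}/g ltr_pdivrMr //; lra.
Qed.

(** Bases differing by one exchange span an edge of the matroid polytope: the functional e_B + e_B1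
    takes the value 2d-1 on both and at most 2d-2 on any other basis. *)
Lemma adjacent_initial B e f : B \in underlying_bases V -> e \in B -> f \notin B ->
  f |: (B :\ e) \in underlying_bases V ->
  exists x, B \in initial_bases V x /\ f |: (B :\ e) \in initial_bases V x.
Proof.
set B1 := f |: _ => Bu eB fB B1u; have dB := underlying_card Bu.
have dB1 := underlying_card B1u.
have e1 : e \notin B1 by rewrite !inE eqxx; case: eqVneq eB fB => // -> ->.
pose u := translate (indicator B) 1 (indicator B1).
have uE (C : {set 'I_n}) : \sum_(i in C) u i = (#|C :&: B| + #|C :&: B1|)%N%:R.
  by rewrite big_split /= -mulr_sumr mul1r !sum_indicator natrD.
have BB1 : #|B1 :&: B|.+1 = d.
  rewrite -dB (cardsD1 e B) eB add1n; congr (_.+1); congr #|pred_of_set _|.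
  apply/setP => z; rewrite !inE; case: (eqVneq z f) => [->|] /=.
    by rewrite (negPf fB) andbF.
  by case: (z == e) => //=; rewrite andbb.
have other C : C \in underlying_bases V -> C != B -> (#|C :&: B| < d)%N.
  move=> Cu CB; rewrite -(underlying_card Cu); apply: proper_card.
  rewrite properE subsetIl /=; apply: contraNN CB => sub.
  rewrite eqEcard dB (underlying_card Cu) leqnn andbT.
  by apply: subset_trans sub (subsetIr _ _).
have other1 C : C \in underlying_bases V -> C != B1 -> (#|C :&: B1| < d)%N.
  move=> Cu CB; rewrite -(underlying_card Cu); apply: proper_card.
  rewrite properE subsetIl /=; apply: contraNN CB => sub.
  rewrite eqEcard dB1 (underlying_card Cu) leqnn andbT.
  by apply: subset_trans sub (subsetIr _ _).
have uB : (#|B :&: B| + #|B :&: B1|)%N.+1 = (d + d)%N.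
  by rewrite setIid dB setIC -addnS BB1.
have uB1 : (#|B1 :&: B| + #|B1 :&: B1|)%N.+1 = (d + d)%N.
  by rewrite setIid dB1 addnC -addnS BB1.
have uC C : C \in underlying_bases V -> C != B -> C != B1 ->
    ((#|C :&: B| + #|C :&: B1|).+1 < d + d)%N.
  by move=> Cu CB CB1; rewrite -addSn -addnS leq_add ?other ?other1.
(* As [e] lies in [B] but not in [B1], this starting point gives both the same weight, and moving
   along [u] keeps the tie. *)
pose x i := if i == e then fine (pcoord V B) - fine (pcoord V B1) else 0.
have wB : weight x B = weight x B1.
  rewrite /weight (big_setD1 e eB) /= {1}/x eqxx !big1; first by lra.
    by move=> i iB; rewrite /x; case: eqVneq iB e1 => // -> ->.
  by move=> i /setD1P[/negPf ie _]; rewrite /x ie.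
have [C Cu|t tu] := @initial_asymptotic x u B Bu.
  rewrite !uE ler_nat -ltnS uB.
  have [->|CB] := eqVneq C B; first by rewrite uB.
  have [->|CB1] := eqVneq C B1; first by rewrite uB1.
  by rewrite ltnW ?uC.
exists (translate x t u).
have wtB : weight (translate x t u) B = weight (translate x t u) B1.
  rewrite !weight_translate wB !uE; congr (_ - _ * _%:R).
  by apply: succn_inj; rewrite uB uB1.
have [C Cm] := initial_bases_neq0 V (translate x t u).
have := tu C Cm; rewrite !uE => /eqP; rewrite eqr_nat -eqSS uB.
have [EC|CB] := eqVneq C B.
  by split; rewrite -?EC //; apply: initial_le Cm _ _ => //; rewrite EC wtB.
have [EC|CB1] := eqVneq C B1.
  by split; rewrite -?EC //; apply: initial_le Cm _ _ => //; rewrite EC wtB.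
by move/eqP => E; have := uC C (initial_underlying Cm) CB CB1; rewrite E ltnn.
Qed.

(** Start far out in direction e_F, where all initial bases attain the rank of [F]. Enlarge within
    that face until its bases witness that [F] is a cyclic flat, then extend to a connected initial
    matroid; the witnesses survive. *)
Lemma facet_initial F : matroid_connected (underlying V) ->
  (forall f, f \in F -> exists2 B, B \in rk_bases (underlying V) F & f \notin B) ->
  (forall e, e \notin F -> exists2 B, B \in rk_bases (underlying V) F & e \in B) ->
  exists x, [/\ matroid_connected (initial V x), cyclic_flat (initial V x) F &
    rk (initial V x) F = rk (underlying V) F].
Proof.
move=> Vconn avoid cover_; set r := rk (underlying V) F.
have leF B : B \in underlying_bases V -> (#|B :&: F| <= r)%N.
  by move=> Bu; apply: (@leq_rk _ (underlying V)).
pose P x := forall B, B \in initial_bases V x -> #|B :&: F| = r.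
pose Q x := (forall f, f \in F -> exists2 B, B \in initial_bases V x & f \notin B) /\
            (forall e, e \notin F -> exists2 B, B \in initial_bases V x & e \in B).
have [x0 P0] : exists x, P x.
  have [B Bu Br] := rk_attained (underlying V) F.
  have [C Cu|t tu] := @initial_asymptotic (fun=> 0) (indicator F) B Bu.
    by rewrite !sum_indicator ler_nat Br leF.
  exists (translate (fun=> 0) t (indicator F)) => C Cm.
  by have /eqP := tu C Cm; rewrite !sum_indicator eqr_nat Br => /eqP.
have [|x1 [P1 [avoid1 cover1] _]] := @exists_maximal_initial P Q x0 _ P0.
  move=> x Px /not_andP[] /existsNP[e /not_implyP[eF none]].
    have xe B : B \in initial_bases V x -> e \in B.
      by move=> Bm; apply: contra_notT none => ?; exists B.
    have FE (B : {set 'I_n}) : ((e \in B) + #|B :&: (F :\ e)|)%N = #|B :&: F|.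
      by rewrite [RHS](cardsD1 e) inE eF andbT setIDA.
    have r0 : (0 < r)%N.
      have [B Bm] := initial_bases_neq0 V x.
      by rewrite -(Px B Bm) -FE xe.
    (* Every basis of [V^x] contains [e], so it meets [F :\ e] in [r.-1] elements. New bases meet it
       in at least [r], hence stay in the face. *)
    have [||x' [lt new]] := @initial_enlarge x (F :\ e) r.-1.
    - by move=> B Bm; have := FE B; rewrite xe // (Px B Bm) => <-.
    - have [B Br eB] := avoid e eF; move: Br; rewrite inE => /andP[Bu /eqP Br].
      by exists B => //; have := FE B; rewrite (negPf eB) Br add0n => ->; rewrite prednK.
    exists x'; split=> // B Bm'; have [Bm|Bm] := boolP (B \in initial_bases V x).
      exact: Px.
    apply/eqP; rewrite eqn_leq leF ?(initial_underlying Bm') //=.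
    have := new B Bm' Bm; rewrite prednK // => h; apply: leq_trans h _.
    by rewrite -(FE B) leq_addl.
  have xe B : B \in initial_bases V x -> e \notin B.
    by move=> Bm; apply: contra_notN none => ?; exists B.
  have FE (B : {set 'I_n}) : #|B :&: (e |: F)| = ((e \in B) + #|B :&: F|)%N.
    rewrite (cardsD1 e) !inE eqxx andbT; congr (_ + #|pred_of_set _|)%N.
    apply/setP => z; rewrite !inE; case: (eqVneq z e) => [->|] //=.
    by rewrite (negPf eF) andbF.
  (* Here no basis of [V^x] contains [e]. New bases have more than [r] elements in [e |: F], hence
     at least [r] in [F]. *)
  have [||x' [lt new]] := @initial_enlarge x (e |: F) r.
  - by move=> B Bm; rewrite FE (negPf (xe B Bm)) (Px B Bm).
  - have [B Br eB] := cover_ e eF; move: Br; rewrite inE => /andP[Bu /eqP Br].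
    by exists B => //; rewrite FE eB Br.
  exists x'; split=> // B Bm'; have [Bm|Bm] := boolP (B \in initial_bases V x).
    exact: Px.
  apply/eqP; rewrite eqn_leq leF ?(initial_underlying Bm') //=.
  by have := new B Bm' Bm; rewrite FE; case: (e \in B); [rewrite add1n|move/ltnW].
have [x conn s1x] := connected_extension x1 Vconn.
have rx : rk (initial V x) F = r.
  apply/eqP; rewrite eqn_leq; apply/andP; split.
    have [B Bm <-] := rk_attained (initial V x) F.
    by apply: leF; apply: initial_underlying Bm.
  have [B Bm] := initial_bases_neq0 V x1.
  by rewrite -(P1 B Bm); apply: leq_rk; apply: (subsetP s1x).
have rkm B : B \in initial_bases V x1 -> B \in rk_bases (initial V x) F.
  by move=> Bm; rewrite inE /= (subsetP s1x _ Bm) rx P1 /=.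
exists x; split=> //; apply: cyclic_flatI; first exact: subsetT.
  by move=> f /avoid1[B Bm fB]; exists B => //; apply: rkm.
by move=> e; rewrite inE => /andP[/cover1[B Bm eB] _]; exists B => //; apply: rkm.
Qed.

(** * The cell of M|F + M/F in direction e_F *)

(** As long as no basis outside [V^x] overtakes, the new minimisers are the bases of [V^x] with most
    elements in [F]. The bound covers small [t] for any [F], and all positive [t] when no underlying
    basis exceeds the rank of [F] in [V^x]. *)
Lemma initial_translate x t F : 0 < t ->
  (forall B0 B, B0 \in initial_bases V x -> B \in underlying_bases V ->
     B \notin initial_bases V x ->
     t * (#|B :&: F|%:R - (rk (initial V x) F)%:R) < weight x B - weight x B0) ->
  initial V (translate x t (indicator F)) = restr_dsum_contr (initial V x) F.
Proof.
move=> t0 small; set r := rk _ F in small.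
apply: matroid_inj; rewrite ?restr_dsum_contr_ground ?restr_dsum_contr_bases //=.
set x' := translate _ _ _.
have rkB B : B \in rk_bases (initial V x) F -> B \in initial_bases V x'.
  rewrite inE => /andP[Bm /eqP Br]; apply/initialP; split.
    exact: initial_underlying Bm.
  move=> C Cu; rewrite !weight_indicator Br -/r.
  have [Cm|Cm] := boolP (C \in initial_bases V x).
    have : t * #|C :&: F|%:R <= t * r%:R.
      by rewrite ler_wpM2l ?(ltW t0) // ler_nat; apply: leq_rk.
    by have := initial_eq Bm Cm; lra.
  have := small B C Bm Cu Cm; lra.
apply/setP => B; apply/idP/idP; last exact: rkB.
move=> Bm'; have [B0 B0m B0r] := rk_attained (initial V x) F.
have B0r' : B0 \in rk_bases (initial V x) F by rewrite inE B0m B0r eqxx.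
have := initial_eq Bm' (rkB _ B0r'); rewrite !weight_indicator B0r -/r => E.
have Bu := initial_underlying Bm'.
have Bm : B \in initial_bases V x.
  by apply: contraT => Bm; have := small B0 B B0m Bu Bm; lra.
rewrite inE /= Bm /= eqn_leq leq_rk //= -/r.
rewrite -(ler_nat R) -(ler_pM2l t0).
have := initial_eq Bm B0m; lra.
Qed.

Lemma initial_translate_small x F : exists z,
  initial V z = restr_dsum_contr (initial V x) F.
Proof.
have [B0 B0m] := initial_bases_neq0 V x.
pose P B := (B \in underlying_bases V) && (B \notin initial_bases V x).
pose g B := (weight x B - weight x B0) / d.+1%:R.
(* The default 1 keeps [t] positive if all bases are initial; the divisor [d.+1] in [g] exceeds
   every [#|B :&: F|]. *)
pose t := \big[Order.min/1]_(B | P B) g B.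
have tpos : 0 < t.
  apply: lt_bigmin => // B /andP[Bu Bm].
  by rewrite divr_gt0 ?ltr0Sn // subr_gt0 initial_lt.
exists (translate x t (indicator F)); apply: initial_translate => //.
move=> B1 B B1m Bu Bm; rewrite (initial_eq B1m B0m).
have : t <= g B by apply: bigmin_le_cond; rewrite /P Bu.
rewrite ler_pdivlMr ?ltr0Sn //; apply: lt_le_trans; rewrite ltr_pM2l //.
have : (#|B :&: F| <= d)%N.
  by rewrite -(underlying_card Bu) subset_leq_card // subsetIl.
rewrite -(ler_nat R) -natr1; have : 0 <= (rk (initial V x) F)%:R :> R by [].
lra.
Qed.

End InitialMatroids.

(** * Matchings and the Stiefel map *)

Section Presentations.
Variables (R : realType) (n d : nat) (V : valuated_matroid R n d).
Variable A : 'I_d -> tpoint R 'I_n.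
Implicit Types (x z : 'I_n -> R) (y : tpoint R 'I_n) (B F S : {set 'I_n}).
Implicit Types (mu : 'I_d -> 'I_n).
Local Open Scope ring_scope.

Lemma tcoord_fine y j : y j != +oo%E -> y j = (fine (y j))%:E.
Proof. by move=> yj; rewrite fineK // fin_numE yj tcoord_Ny. Qed.

Lemma notin_relsuppP x y j :
  reflect (y j != +oo%E /\ forall k, y k != +oo%E -> fine (y j) - x j <= fine (y k) - x k)
          (j \notin relsupp x y).
Proof.
rewrite inE; apply: (iffP existsPn) => [nlt|[yj jmin] k].
  have yj : y j != +oo%E.
    have [k yk] := tcoord_fin y; apply: contraNneq (nlt k) => ->.
    by rewrite (tcoord_fine yk) -EFinB ltry.
  split=> // k yk; have := nlt k.
  by rewrite (tcoord_fine yk) (tcoord_fine yj) -!EFinB lte_fin -leNgt.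
have [yk|yk] := eqVneq (y k) +oo%E; first by rewrite yk -leNgt leey.
by rewrite (tcoord_fine yk) (tcoord_fine yj) -!EFinB lte_fin -leNgt jmin.
Qed.

Lemma relsupp_proper x y : exists j, j \notin relsupp x y.
Proof.
have [j0 y0] := tcoord_fin y.
case: (@Order.TotalTheory.arg_minP _ _ _ j0 (fun j => y j != +oo%E)
  (fun j => fine (y j) - x j) y0) => j yj jmin.
by exists j; apply/notin_relsuppP.
Qed.

Lemma stiefel_le (b : dsubset n d) mu : [set mu i | i : 'I_d] = val b ->
  (stiefel A b <= \sum_i A i (mu i))%E.
Proof.
move=> mub; rewrite (eq_bigr (fun i => A i ([ffun k => mu k] i))).
  apply: bigmin_le_cond; rewrite -mub; apply/eqP/eq_imset => i.
  by rewrite ffunE.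
by move=> i _; rewrite ffunE.
Qed.

(** A minimum below its default +oo is attained. The minimiser is injective since it maps [d] rows
    onto [d] columns, and a finite sum has only finite terms. *)
Lemma stiefel_attained (b : dsubset n d) : stiefel A b != +oo%E ->
  exists mu, [/\ injective mu, [set mu i | i : 'I_d] = val b,
    forall i, A i (mu i) != +oo%E &
    stiefel A b = (\sum_i fine (A i (mu i)))%:E].
Proof.
move=> fin; have [mu mub E] : exists2 mu : {ffun 'I_d -> 'I_n},
    [set mu i | i : 'I_d] = val b & stiefel A b = (\sum_i A i (mu i))%E.
  apply: contrapT => none; move/eqP: fin; apply; rewrite /stiefel.
  apply: big1_seq => mu /andP[/eqP mub _]; apply: contrapT => /eqP mufin.
  apply: none; have P0 : [set mu i | i : 'I_d] == val b by apply/eqP.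
  have [|nu /eqP nub E] := @eq_bigmin _ _ _ +oo%E mu
    (fun j : {ffun 'I_d -> 'I_n} => [set j i | i : 'I_d] == val b)
    (fun j : {ffun 'I_d -> 'I_n} => (\sum_i A i (j i))%E) P0.
    by move=> nu _; apply: leey.
  by exists nu.
have muI : injective mu.
  apply/injectiveP; rewrite -[injectiveb mu]/(dinjectiveb mu predT).
  apply/dinjectiveP/imset_injP; rewrite mub card_ord; exact: (valP b).
have mufin i : A i (mu i) != +oo%E.
  apply: contraNneq fin => Ai; rewrite E esum_eqy => [|k _]; last exact: tcoord_Ny.
  by apply/exists_inP; exists i => //; apply/eqP.
exists mu; split=> //; rewrite E -sumEFin; apply: eq_bigr => i _.
exact: tcoord_fine.
Qed.

Lemma card_image_inter mu F : injective mu ->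
  #|[set mu i | i : 'I_d] :&: F| = #|[set i | mu i \in F]|.
Proof.
move=> muI; rewrite -(card_imset _ muI); congr #|pred_of_set _|.
apply/setP => j; rewrite inE; apply/andP/imsetP.
  by case=> /imsetP[i _ ->] iF; exists i; rewrite ?inE.
by case=> i; rewrite inE => iF ->; split=> //; apply: imset_f.
Qed.

(** Swapping within rows preserves the total, so only the move of row [i] to [j] counts. It is
    applied with [G] the tilted entries and with [G] the indicator of [F]. *)
Lemma sum_rebalance (G : 'I_d -> 'I_n -> R) mu (nu : 'I_d -> 'I_n) (S : {set 'I_d}) i j :
  let mu' k := if k == i then j else mu k in
  \sum_k G k (if k \in S then nu k else mu' k) +
  \sum_k G k (if k \in S then mu' k else nu k) =
  \sum_k G k (mu k) + \sum_k G k (nu k) + (G i j - G i (mu i)).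
Proof.
move=> mu'; rewrite -big_split /=.
rewrite (eq_bigr (fun k => G k (mu' k) + G k (nu k))).
  rewrite big_split /= (bigD1 i) //= [\sum_k G k (mu k)](bigD1 i) //= /mu' eqxx.
  rewrite (eq_bigr (fun k => G k (mu k))); first lra.
  by move=> k /negPf ->.
by move=> k _; case: (k \in S); rewrite // addrC.
Qed.

(** * Necessity: tightness of optimal matchings *)

Section Forward.
Variable c : R.
Hypothesis presE : forall b, stiefel A b = (V b + c%:E)%E.

Lemma presentation_bound mu : injective mu -> (forall i, A i (mu i) != +oo%E) ->
  [set mu i | i : 'I_d] \in underlying_bases V /\
  fine (pcoord V [set mu i | i : 'I_d]) + c <= \sum_i fine (A i (mu i)).
Proof.
move=> muI mufin; set B := [set mu i | i : 'I_d].
have cB : #|B| == d by rewrite card_imset // card_ord.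
have := @stiefel_le (Sub B cB) mu erefl; rewrite presE.
rewrite (eq_bigr (fun i => (fine (A i (mu i)))%:E)) => [|i _]; last exact: tcoord_fine.
rewrite sumEFin -[V _](pcoordE V) /=.
have := @underlyingE _ _ _ V B; case: eqVneq => [-> _|_ Bu]; first by rewrite leye_eq.
by rewrite (underlying_fin Bu) -EFinD lee_fin.
Qed.

Lemma presentation_attained B : B \in underlying_bases V ->
  exists mu, [/\ injective mu, forall i, A i (mu i) != +oo%E,
    [set mu i | i : 'I_d] = B &
    \sum_i fine (A i (mu i)) = fine (pcoord V B) + c].
Proof.
move=> Bu; have cB : #|B| == d by apply/eqP; apply: underlying_card Bu.
have E : stiefel A (Sub B cB) = (fine (pcoord V B) + c)%:E.
  by rewrite presE -[V _](pcoordE V) /= {1}(underlying_fin Bu).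
have [|mu [muI mub mufin Emu]] := @stiefel_attained (Sub B cB); first by rewrite E.
exists mu; split=> //; move: Emu; rewrite E; by case.
Qed.

Lemma matching_weight_bound x B0 mu : B0 \in initial_bases V x ->
  injective mu -> (forall i, A i (mu i) != +oo%E) ->
  weight V x B0 + c <= \sum_i (fine (A i (mu i)) - x (mu i)) /\
  (\sum_i (fine (A i (mu i)) - x (mu i)) = weight V x B0 + c ->
   [set mu i | i : 'I_d] \in initial_bases V x).
Proof.
move=> B0m muI mufin; have [Bu le] := presentation_bound muI mufin.
have := initial_min B0m Bu; rewrite {2}/weight sumrB.
have -> : \sum_(i in [set mu i | i : 'I_d]) x i = \sum_i x (mu i).
  by rewrite big_imset //=; move=> ? ? _ _; apply: muI.
move=> le'; split; first lra.
move=> E; apply: (initial_le B0m Bu); rewrite {1}/weight.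
have -> : \sum_(i in [set mu i | i : 'I_d]) x i = \sum_i x (mu i).
  by rewrite big_imset //=; move=> ? ? _ _; apply: muI.
lra.
Qed.

(** Both matchings obtained by rebalancing cost at least the optimum, so moving row [i] to [j]
    cannot gain. If it loses nothing, both are optimal and their images are again bases of [V^x]. *)
Lemma matching_tight x mu i j : injective mu -> (forall i, A i (mu i) != +oo%E) ->
  [set mu i | i : 'I_d] \in initial_bases V x ->
  \sum_i fine (A i (mu i)) = fine (pcoord V [set mu i | i : 'I_d]) + c ->
  (exists2 B, B \in initial_bases V x & j \notin B) \/ (forall k, k = j) ->
  A i j != +oo%E ->
  fine (A i (mu i)) - x (mu i) <= fine (A i j) - x j /\
  (fine (A i (mu i)) - x (mu i) = fine (A i j) - x j ->
   forall F r, (forall B, B \in initial_bases V x -> #|B :&: F| = r) ->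
   (j \in F) = (mu i \in F)).
Proof.
move=> muI mufin B0m muE [[B Bm jB]|all_j] Aij; last by rewrite (all_j (mu i)).
set B0 := [set mu i | i : 'I_d] in B0m muE.
have muw : \sum_i (fine (A i (mu i)) - x (mu i)) = weight V x B0 + c.
  rewrite sumrB muE /weight addrAC big_imset //=; move=> ? ? _ _; exact: muI.
have [nu [nuI nufin nuB nuE]] := presentation_attained (initial_underlying Bm).
have nuw : \sum_i (fine (A i (nu i)) - x (nu i)) = weight V x B0 + c.
  rewrite (initial_eq B0m Bm) sumrB nuE /weight addrAC -nuB big_imset //=.
  by move=> ? ? _ _; apply: nuI.
have nuj k : nu k != j.
  by apply: contraNneq jB => <-; rewrite -nuB; apply: imset_f.
have [S [mu2I nu2I]] := matching_rebalance i muI nuI nuj.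
set mu' := (fun k => if k == i then j else mu k) in mu2I nu2I.
set mu2 := (fun k => if k \in S then nu k else mu' k) in mu2I.
set nu2 := (fun k => if k \in S then mu' k else nu k) in nu2I.
have mu'fin k : A k (mu' k) != +oo%E by rewrite /mu'; case: (eqVneq k i) => [->|].
have mu2fin k : A k (mu2 k) != +oo%E by rewrite /mu2; case: ifP.
have nu2fin k : A k (nu2 k) != +oo%E by rewrite /nu2; case: ifP.
have := sum_rebalance (fun k l => fine (A k l) - x l) mu nu S i j.
rewrite /= -/mu' muw nuw => sumE.
have [le1 im1] := matching_weight_bound B0m mu2I mu2fin.
have [le2 im2] := matching_weight_bound B0m nu2I nu2fin.
rewrite /mu2 in le1 im1; rewrite /nu2 in le2 im2.
split; first by lra.
move=> tight F r xF.
have m1 : [set mu2 k | k : 'I_d] \in initial_bases V x by apply: im1; lra.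
have m2 : [set nu2 k | k : 'I_d] \in initial_bases V x by apply: im2; lra.
have cnt (la : 'I_d -> 'I_n) : injective la ->
    [set la k | k : 'I_d] \in initial_bases V x ->
    \sum_k (la k \in F)%:R = r%:R :> R.
  move=> laI lam; rewrite -(xF _ lam) card_image_inter // -natr_sum -sum1_card.
  by rewrite [in RHS]big_mkcond; congr (_%:R); apply: eq_bigr => k _; rewrite inE.
(* All four images have [r] elements in [F], so the move of row [i] cannot change membership in
   [F]. *)
have := sum_rebalance (fun k l => (l \in F)%:R) mu nu S i j.
rewrite /= -/mu' (cnt _ mu2I m1) (cnt _ nu2I m2) (cnt _ muI B0m) (cnt _ nuI).
  move=> E; have /eqP : (j \in F)%:R = (mu i \in F)%:R :> R by lra.
  by rewrite eqr_nat; do 2 case: (_ \in F).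
by rewrite nuB.
Qed.

(** Match the rows tightly onto a basis attaining the rank of [F]: a row with no minimum in [F] is
    matched to one of its elements outside [F], and there are cork(F) of them. *)
Lemma presentation_sigma0 x F : matroid_connected (initial V x) ->
  (sigma0 V A F x <= cork (initial V x) F)%N.
Proof.
move=> conn; have [B Bm BF] := rk_attained (initial V x) F.
have [mu [muI mufin muB muE]] := presentation_attained (initial_underlying Bm).
rewrite /cork -BF (rank_card Bm) -cardsD -muB setDE (card_image_inter _ muI).
apply/subset_leq_card/subsetP => i; rewrite !inE => /asboolP[_ /subsetP sF].
apply/negP => /sF; apply/negP/notin_relsuppP; split=> // j Aij.
have [|||//] := @matching_tight x mu i j muI mufin _ _ _ Aij; rewrite ?muB //.
have [[B' B'm jB']|/setP all_j] := connected_avoid conn (in_setT j); [left|right].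
  by exists B'.
by move=> k; have := all_j k; rewrite !inE => /esym/eqP.
Qed.

Lemma presentation_sigmainf x F : (forall i, trop_linear_space V (A i)) ->
  matroid_connected (initial V x) -> cyclic_flat (initial V x) F ->
  sigmainf V A F x = cork (initial V x) F.
Proof.
move=> AL conn cycF; have [z0 z0N] := initial_translate_small V x F.
set r := rk (initial V x) F.
have zm z B : relint_L V (restr_dsum_contr (initial V x) F) z ->
    (B \in initial_bases V z) = (B \in rk_bases (initial V x) F).
  by move=> zN; rewrite -restr_dsum_contr_bases -zN.
have zF z B : relint_L V (restr_dsum_contr (initial V x) F) z ->
    B \in initial_bases V z -> #|B :&: F| = r.
  by move=> zN; rewrite zm // inE => /andP[_ /eqP].
(* No column is a coloop at [z] unless it is the only column: inside [F] because [F] is cyclic,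
   outside because a basis of the connected [V^x] avoids it and an exchange keeps the rank in
   [F]. *)
have avoid z j : relint_L V (restr_dsum_contr (initial V x) F) z ->
    (exists2 B, B \in initial_bases V z & j \notin B) \/ (forall k, k = j).
  move=> zN; have [jF|jF] := boolP (j \in F).
    have [B Br jB] := cyclic_flat_avoid cycF jF.
    by left; exists B; rewrite ?zm.
  have [[B Bm jB]|/setP all_j] := connected_avoid conn (in_setT j); [left|right].
    have [B' B'r jB'] := rk_bases_avoid Bm jB jF.
    by exists B'; rewrite ?zm.
  by move=> k; have := all_j k; rewrite !inE => /esym/eqP.
have [B Bm] := initial_bases_neq0 V z0.
have [mu [muI mufin muB muE]] := presentation_attained (initial_underlying Bm).
(* The single matching [mu], chosen at [z0], is tight at every [z] of the cell, since all these
   points have the same initial matroid. *)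
have tight z i j : relint_L V (restr_dsum_contr (initial V x) F) z ->
    A i j != +oo%E ->
    fine (A i (mu i)) - z (mu i) <= fine (A i j) - z j /\
    (fine (A i (mu i)) - z (mu i) = fine (A i j) - z j -> (j \in F) = (mu i \in F)).
  move=> zN Aij; have [|||le eqF] := @matching_tight z mu i j muI mufin _ _ _ Aij.
  - by rewrite muB zm // -(zm z0).
  - by rewrite muB.
  - exact: avoid.
  - by split=> // E; apply: (eqF E F r) => B' B'm; apply: zF B'm.
have -> : cork (initial V x) F = #|[set i | mu i \in ~: F]|.
  have Br : B \in rk_bases (initial V x) F by rewrite -(zm z0).
  have B'm : B \in bases (initial V x) by move: Br; rewrite inE => /andP[].
  rewrite -card_image_inter // muB -setDE cardsD /cork (rank_card B'm).
  by rewrite (zF z0).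
congr #|pred_of_set _|; apply/setP => i; rewrite !inE; apply/asboolP/idP.
  move=> /(_ z0 z0N)[_ /subsetP sF]; apply/negP => /sF; apply/negP/notin_relsuppP.
  by split=> // j Aij; case: (tight z0 i j z0N Aij).
(* A minimum in [F] would tie with the matched column outside [F]. *)
move=> iF z zN; split=> //; apply/subsetP => j jF; apply: contraT.
move=> /notin_relsuppP[Aij jmin]; have [le /(_ _)] := tight z i j zN Aij.
rewrite jF (negPf iF) => E; suff /E : fine (A i (mu i)) - z (mu i) = fine (A i j) - z j by [].
by apply/eqP; rewrite eq_le le jmin.
Qed.

End Forward.

(* For [y] in the linear space, the complement of [relsupp x y] meets no circuit
   of the initial matroid in a single element. *)
Lemma relsupp_closed x y B S e : trop_linear_space V y ->
  B \in initial_bases V x -> S \subset B -> e \notin B ->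
  (rk (initial V x) (e |: S) <= #|S|)%N -> S \subset relsupp x y ->
  e \in relsupp x y.
Proof.
move=> yL Bm SB eB Se Sy; apply: contraT => /notin_relsuppP[ye emin].
have Bu := initial_underlying Bm.
have cC : #|e |: B| = d.+1 by rewrite cardsU1 eB (underlying_card Bu).
have [j [k [jC kC jk Ejk jmin]]] := yL _ cC.
have eBe : (e |: B) :\ e = B.
  by apply/setP => z; rewrite !inE; case: (eqVneq z e) => [->|] //=; rewrite (negPf eB).
(* The minimum is attained twice, so some [l] other than [e] does at least as well as [e]. Since [e]
   is minimal in [y - x] and [B] in weight, both hold with equality: [B'] is initial and [l] is
   outside [relsupp x y]. *)
have [l [lC le lmin]] : exists l, [/\ l \in e |: B, l != e &
    (y l + pcoord V ((e |: B) :\ l) <= y e + pcoord V B)%E].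
  have := jmin e (setU11 _ _); rewrite eBe => je.
  have [E|jne] := eqVneq j e; last by exists j.
  by exists k; rewrite -Ejk; split=> //; rewrite -E eq_sym.
have lB : l \in B by move: lC; rewrite !inE (negPf le).
set B' := _ :\ l in lmin.
move: lmin; rewrite (tcoord_fine ye) (underlying_fin Bu) -EFinD => lmin.
have yl : y l != +oo%E.
  apply: contraTneq lmin => ->; rewrite -ltNge addye ?ltry //; exact: pcoord_Ny.
have B'u : B' \in underlying_bases V.
  rewrite underlyingE; apply: contraTneq lmin => ->.
  by rewrite -ltNge addey ?ltry //; exact: tcoord_Ny.
move: lmin; rewrite (tcoord_fine yl) (underlying_fin B'u) -EFinD lee_fin => lmin.
have xB' : \sum_(i in B') x i = \sum_(i in B) x i + x e - x l.
  have : \sum_(i in e |: B) x i = x l + \sum_(i in B') x i by rewrite (big_setD1 l).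
  rewrite big_setU1 //=; lra.
have B'm : B' \in initial_bases V x.
  apply: (initial_le Bm B'u); rewrite /weight xB'.
  have := emin l yl; lra.
have lr : l \notin relsupp x y.
  apply/notin_relsuppP; split=> // i yi; have := emin i yi.
  have := initial_eq Bm B'm; rewrite /weight xB'; lra.
have lS : l \notin S by apply: contra lr; apply: (subsetP Sy).
have eS : e \notin S by apply: contra eB; apply: (subsetP SB).
(* As [l] is not in [S], the basis [B'] contains all of [e |: S], which is too large for the rank
   bound. *)
have := leq_trans (leq_rk (M := initial V x) (e |: S) B'm) Se.
rewrite (setIidPr _); first by rewrite cardsU1 eS add1n ltnn.
apply/subsetP => z; rewrite !inE => /orP[/eqP->|zS].
  by rewrite eqxx eq_sym le.
by rewrite (subsetP SB z zS) orbT andbT; apply: contraNneq lS => <-.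
Qed.

(** * Sufficiency: recovering the valuation *)

Section Backward.
Hypothesis AL : forall i, trop_linear_space V (A i).

(** Hall's condition, with columns choosing rows: a row not tight at any column of [S] has no tight
    column in the flat spanned by [S], so by (1) there are at most d - |S| such rows. *)
Lemma local_matching x B :
  (forall F, flat (initial V x) F -> (sigma0 V A F x <= cork (initial V x) F)%N) ->
  B \in initial_bases V x ->
  exists mu, [/\ injective mu, [set mu i | i : 'I_d] = B &
    forall i, mu i \notin relsupp x (A i)].
Proof.
move=> h Bm; have cB := initial_card Bm.
have [|g [gN gI]] := @hall _ _ B [ffun b => [set i | b \notin relsupp x (A i)]].
  move=> S SB.
  have rkS S' : S' \subset B -> rk (initial V x) S' = #|S'|.
    move=> S'B; apply/eqP; rewrite eqn_leq; apply/andP; split.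
      have [B' _ <-] := rk_attained (initial V x) S'.
      by rewrite subset_leq_card // subsetIr.
    by rewrite -{1}(setIidPr S'B); apply: leq_rk.
  (* A largest such [F] is the closure of [S]. *)
  pose P F := (S \subset F) && (rk (initial V x) F == #|S|).
  have P0 : P S by rewrite /P subxx rkS ?eqxx.
  case: (@arg_maxnP _ S P (fun F => #|F|) P0) => F /andP[SF /eqP rF] Fmax.
  have flatF : flat (initial V x) F.
    rewrite /flat subsetT; apply/forall_inP => e; rewrite inE => /andP[eF _].
    rewrite ltnNge; apply/negP => le.
    have : P (e |: F).
      rewrite /P (subset_trans SF (subsetUr _ _)) -rF eqn_leq le.
      by rewrite rk_sub // subsetUr.
    by move/Fmax; rewrite /= cardsU1 eF add1n ltnn.
  have := h F flatF; rewrite /cork rF (@rank_card _ (initial V x) _ Bm) cB => s0.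
  have Sd : (#|S| <= d)%N by rewrite -cB subset_leq_card.
  set U := \bigcup_(b in S) _.
  rewrite -(leq_add2r #|~: U|) cardsC card_ord -leq_subRL //.
  apply: leq_trans s0; apply/subset_leq_card/subsetP => i; rewrite !inE => iN.
  have Si : S \subset relsupp x (A i).
    apply/subsetP => b bS; apply: contraNT iN => bi; apply/bigcupP; exists b => //.
    by rewrite ffunE inE.
  apply/asboolP; split=> //; apply/subsetP => e eF.
  have [eS|eS] := boolP (e \in S); first exact: (subsetP Si).
  have rke : (rk (initial V x) (e |: S) <= #|S|)%N.
    by rewrite -rF rk_sub // subUset sub1set eF.
  apply: (@relsupp_closed x (A i) B S e) => //.
  apply: contraTN rke => eB; rewrite -ltnNge rkS ?cardsU1 ?eS //.
  by rewrite subUset sub1set eB.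
have onto i : exists b, b \in B /\ g b = Some i.
  have : Some i \in [set g b | b in B].
    suff /eqP -> : [set g b | b in B] == [set Some k | k : 'I_d] by apply: imset_f.
    rewrite eqEcard card_in_imset // cB card_imset ?card_ord ?leqnn ?andbT; last first.
      by move=> ? ? [].
    by apply/subsetP => _ /imsetP[b bB ->]; have [k -> _] := gN b bB; apply: imset_f.
  by case/imsetP => b bB ->; exists b.
have [mu muP] := fin_all_exists onto.
have muI : injective mu.
  by move=> i k E; have [_ Ei] := muP i; have [_] := muP k; rewrite -E Ei => -[].
exists mu; split=> //.
  apply/eqP; rewrite eqEcard card_imset // card_ord cB leqnn andbT.
  by apply/subsetP => _ /imsetP[i _ ->]; case: (muP i).
move=> i; have [iB gi] := muP i; have [k] := gN _ iB.
by rewrite gi => -[<-]; rewrite ffunE inE.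
Qed.

(** Any matching onto [B] costs at least the sum [s] of the row minima of [A - x] plus the sum of
    [x] over [B], and a tight one attains this. On bases of [V^x], [V] is also a constant plus that
    sum. *)
Lemma local_stiefel x :
  (forall F, flat (initial V x) F -> (sigma0 V A F x <= cork (initial V x) F)%N) ->
  exists h : R, forall B, B \in initial_bases V x ->
    pcoord (stiefel A) B = (pcoord V B + h%:E)%E.
Proof.
move=> hx; have [k kmin] := fin_all_exists (fun i => relsupp_proper x (A i)).
have [B0 B0m] := initial_bases_neq0 V x.
pose s := \sum_i (fine (A i (k i)) - x (k i)).
exists (s - weight V x B0) => B Bm; have Bu := initial_underlying Bm.
rewrite (initial_eq B0m Bm) (underlying_fin Bu) -EFinD.
have -> : fine (pcoord V B) + (s - weight V x B) = s + \sum_(i in B) x i.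
  by rewrite /weight; lra.
have cB : #|B| == d by apply/eqP; apply: initial_card Bm.
have -> : pcoord (stiefel A) B = stiefel A (Sub B cB).
  by rewrite /pcoord insubT.
have sumE (mu : 'I_d -> 'I_n) : injective mu -> [set mu i | i : 'I_d] = B ->
    \sum_i fine (A i (mu i)) = \sum_i (fine (A i (mu i)) - x (mu i)) + \sum_(i in B) x i.
  by move=> muI <-; rewrite big_imset /= ?sumrB ?subrK // => ? ? _ _; apply: muI.
have [mu [muI muB mur]] := local_matching hx Bm.
have Amu i : A i (mu i) != +oo%E by case/notin_relsuppP: (mur i).
have musum : \sum_i fine (A i (mu i)) = s + \sum_(i in B) x i.
  rewrite sumE //; congr (_ + _); apply: eq_bigr => i _; apply/eqP; rewrite eq_le.
  have /notin_relsuppP[Ak kle] := kmin i; have /notin_relsuppP[_ mule] := mur i.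
  by rewrite kle // mule.
have ub : (stiefel A (Sub B cB) <= (s + \sum_(i in B) x i)%:E)%E.
  apply: le_trans (@stiefel_le (Sub B cB) mu muB) _.
  rewrite (eq_bigr (fun i => (fine (A i (mu i)))%:E)) => [|i _]; last exact: tcoord_fine.
  by rewrite sumEFin musum.
have fin : stiefel A (Sub B cB) != +oo%E.
  by rewrite -ltey; apply: le_lt_trans ub (ltry _).
have [nu [nuI nuB Anu E]] := stiefel_attained fin.
apply/eqP; rewrite eq_le ub /= E lee_fin sumE // lerD2r; apply: ler_sum => i _.
by have /notin_relsuppP[_ kle] := kmin i; apply: kle.
Qed.

(** Rows in [Rinf] are infinite on [F], so by (2) at most rk(F) rows can be matched into [F],
    whereas [B] has more elements there. *)
Lemma stiefel_nonbasis B :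
  matroid_connected (underlying V) ->
  (forall x F, matroid_connected (initial V x) -> cyclic_flat (initial V x) F ->
     sigmainf V A F x = cork (initial V x) F) ->
  B \notin underlying_bases V -> pcoord (stiefel A) B = +oo%E.
Proof.
move=> Vconn hinf Bu; rewrite /pcoord; case: insubP => // b /eqP cB bB /=.
have Bdep : (rk (underlying V) B < #|B|)%N.
  have [B' B'u <-] := rk_attained (underlying V) B.
  apply: proper_card; rewrite properE subsetIr /=; apply: contraNN Bu => sub.
  suff -> : B = B' by [].
  apply/eqP; rewrite eqEcard cB (underlying_card B'u) leqnn andbT.
  exact: subset_trans sub (subsetIl _ _).
have [F [_ FB avoid cover_]] := @dependent_cyclic _ (underlying V) B (subsetT _) Bdep.
have [|x [conn cycF rF]] := facet_initial Vconn avoid.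
  by move=> e eF; apply: cover_; rewrite inE eF in_setT.
have far t : 0 < t -> relint_L V (restr_dsum_contr (initial V x) F)
    (translate x t (indicator R F)).
  move=> t0; apply: initial_translate => // B1 B2 B1m B2u B2m.
  apply: le_lt_trans (_ : 0 < _); last by rewrite subr_gt0 initial_lt.
  rewrite mulr_ge0_le0 ?(ltW t0) // subr_le0 ler_nat rF.
  exact: (@leq_rk _ (underlying V)).
apply/eqP; apply: contraT => fin; have [mu [muI mub Amu _]] := stiefel_attained fin.
have sub : [set i | mu i \in F] \subset ~: [set i | `[< Rinf V F x (A i) >]].
  apply/subsetP => i; rewrite !inE => iF; apply/negP => /asboolP Ri.
  have [k0 /notin_relsuppP[_ k0min]] := relsupp_proper x (A i).
  (* A shift by [t] along e_F puts column [mu i] strictly below every column outside [F], so the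
     minimum would lie in [F]. *)
  pose t := 1 + (fine (A i (mu i)) - x (mu i)) - (fine (A i k0) - x k0).
  have t0 : 0 < t by have := k0min _ (Amu i); rewrite /t; lra.
  have [_ /subsetP Fz] := Ri _ (far t t0).
  have [k kz] := relsupp_proper (translate x t (indicator R F)) (A i).
  have kF : k \notin F by apply: contra kz; apply: Fz.
  have /notin_relsuppP[Ak /(_ _ (Amu i))] := kz.
  rewrite /translate /indicator (negPf kF) iF /= mulr0 mulr1 addr0.
  by have := k0min k Ak; rewrite /t; lra.
have := subset_leq_card sub.
rewrite -card_image_inter // mub bB [B :&: F]setIC [leqRHS]cardsCs setCK card_ord -/(sigmainf V A F x).
rewrite hinf // /cork; have [B0 B0m] := initial_bases_neq0 V x.
rewrite (@rank_card _ (initial V x) _ B0m) (initial_card B0m) rF.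
have : (rk (underlying V) F <= d)%N.
  have [B' B'u <-] := rk_attained (underlying V) F.
  by rewrite -(underlying_card B'u) subset_leq_card // subsetIl.
by move=> rd; rewrite subKn // leqNgt FB.
Qed.

(** Walk from [B] to [B'] by exchanges. Consecutive bases share a connected [V^x], whose local
    constant is fixed by the finite coordinate at the first of them. *)
Lemma stiefel_basis_const (h : R) :
  matroid_connected (underlying V) ->
  (forall x F, matroid_connected (initial V x) -> flat (initial V x) F ->
     (sigma0 V A F x <= cork (initial V x) F)%N) ->
  forall B B', B \in underlying_bases V -> B' \in underlying_bases V ->
  pcoord (stiefel A) B = (pcoord V B + h%:E)%E ->
  pcoord (stiefel A) B' = (pcoord V B' + h%:E)%E.
Proof.
move=> Vconn h0 B B' + B'u; have [m] := ubnP #|B :\: B'|.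
elim: m B => // m IH B lem Bu EB.
have [sub|/subsetPn[e eB eB']] := boolP (B \subset B').
  suff <- : B = B' by [].
  by apply/eqP; rewrite eqEcard sub (underlying_card Bu) (underlying_card B'u) leqnn.
have [f [fB' fB B1u]] := @bases_exchange _ (underlying V) _ _ _ Bu B'u eB eB'.
have [x0 [Bx0 B1x0]] := adjacent_initial Bu eB fB B1u.
have [x conn sx] := connected_extension x0 Vconn.
have [h' h'P] := local_stiefel (fun F => h0 x F conn).
have hh' : h = h'.
  have := h'P B (subsetP sx _ Bx0); rewrite EB (underlying_fin Bu) -!EFinD.
  by case=> /addrI.
apply: (IH (f |: (B :\ e))) => //; last by rewrite hh' h'P // (subsetP sx).
move: lem; rewrite ltnS; apply: leq_trans; apply: proper_card; apply/properP; split.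
  apply/subsetP => z; rewrite !inE => /andP[z2].
  by case: (eqVneq z f) z2 => [->|_ z2 /andP[_ ->]]; rewrite ?fB' // z2.
by exists e; rewrite !inE ?eB ?eB' // eqxx; case: eqVneq eB fB => // -> ->.
Qed.

End Backward.
End Presentations.

(** * The equivalence *)

(** A loop of a connected matroid is its only element. Then the bases of [V^x] are empty, so d = 0
    and the element is a loop of the underlying matroid too. Hence the conditions apply to every
    connected [V^x]. *)
Lemma connected_initial_matroids (R : realType) (n d : nat)
    (V : valuated_matroid R n d) (x : 'I_n -> R) :
  matroid_connected (initial V x) -> initial_matroids V (initial V x).
Proof.
move=> conn; split; first by exists x.
move=> e /andP[_ eloop]; rewrite /loop in_setT /=.
have no B : B \in initial_bases V x -> e \notin B.
  move=> Bm; apply: contra eloop => eB; apply/exists_inP; exists B => //.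
  by rewrite sub1set.
have [[B Bm eB]|/setP all_e] := connected_cover conn (in_setT e).
  by rewrite (negPf (no B Bm)) in eB.
apply/exists_inP => -[B Bu]; rewrite sub1set => eB.
have [B0 B0m] := initial_bases_neq0 V x.
have : (0 < #|B0|)%N.
  by rewrite (initial_card B0m) -(underlying_card Bu) (cardsD1 e) eB.
move=> /card_gt0P[f f0]; have := all_e f; rewrite !inE => /esym/eqP fe.
by rewrite fe (negPf (no B0 B0m)) in f0.
Qed.

Theorem theorem4p12 (R : realType) (n d : nat) (V : valuated_matroid R n d)
    (A : 'I_d -> tpoint R 'I_n)
    (V_connected : matroid_connected (underlying V))
    (A_in_L : forall i, trop_linear_space V (A i)) :
  presentation A V <->
  (forall M : matroid 'I_n, initial_matroids V M -> matroid_connected M ->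
   forall xM : 'I_n -> R, relint_L V M xM ->
     (forall F : {set 'I_n}, flat M F -> sigma0 V A F xM <= cork M F) /\
     (forall F : {set 'I_n}, cyclic_flat M F -> sigmainf V A F xM = cork M F)).
Proof.
split=> [[c presE] M _ + x xM|cond].
  rewrite -{}xM => conn; split=> F; first by move=> _; apply: (presentation_sigma0 presE).
  exact: (presentation_sigmainf presE A_in_L conn).
have h0 x F : matroid_connected (initial V x) -> flat (initial V x) F ->
    sigma0 V A F x <= cork (initial V x) F.
  by move=> conn; have [+ _] := cond _ (connected_initial_matroids conn) conn x erefl; apply.
have hinf x F : matroid_connected (initial V x) -> cyclic_flat (initial V x) F ->
    sigmainf V A F x = cork (initial V x) F.
  by move=> conn; have [_] := cond _ (connected_initial_matroids conn) conn x erefl; apply.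
(* Any connected initial matroid fixes the global constant [h]. *)
have [x conn _] := connected_extension (fun=> 0%R) V_connected.
have [h hP] := local_stiefel A_in_L (fun F => h0 x F conn).
have [B0 B0m] := initial_bases_neq0 V x.
exists h => b; rewrite -(pcoordE V b).
have -> : stiefel A b = pcoord (stiefel A) (val b) by rewrite /pcoord valK.
have [bu|bu] := boolP (val b \in underlying_bases V).
  apply: stiefel_basis_const V_connected h0 _ _ (initial_underlying B0m) bu (hP _ B0m).
  exact: A_in_L.
rewrite (stiefel_nonbasis V_connected hinf bu).
by move: bu; rewrite underlyingE negbK => /eqP ->.
Qed.
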